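(* Let $\vec p=(p_1,\dots,p_n)$ with $1<p_i<\infty$ for all $i$, and let $1<\frac{n}{\sum_{i=1}^n1/p_i}<t<r<\infty$. Then the mixed Bourgain-Morrey space $M_{\vec p}^{t,r}$ is reflexive.
   Context: $\mathcal D$ is the family of dyadic cubes $Q_{j,k}=\prod_{i=1}^n[2^{-j}k_i,2^{-j}(k_i+1))$, $j\in\mathbb Z$, $k\in\mathbb Z^n$. Mixed Lebesgue norm: for measurable $f$ on $\mathbb R^n$, $$\|f\|_{L^{\vec p}}=\Big(\int_{\mathbb R}\cdots\Big(\int_{\mathbb R}|f(x_1,\dots,x_n)|^{p_1}dx_1\Big)^{p_2/p_1}\cdots dx_n\Big)^{1/p_n}$$ (innermost integration in $x_1$). Mixed Bourgain-Morrey space $M_{\vec p}^{t,r}$ ($r<\infty$): the space of all measurable $f$ on $\mathbb R^n$ with $$\|f\|_{M_{\vec p}^{t,r}}=\Big(\sum_{Q\in\mathcal D}|Q|^{\frac rt-\frac rn\sum_{i=1}^n\frac1{p_i}}\|f\chi_Q\|_{L^{\vec p}}^r\Big)^{1/r}<\infty,$$ normed by this quantity. *)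

(* Defs.v *)
From HB Require Import structures.
From mathcomp Require Import all_boot all_order all_algebra.
From mathcomp Require Import complex ring.
From mathcomp Require Import all_classical all_reals all_analysis.
From mathcomp Require Import measurable_realfun.

Set Implicit Arguments.
Unset Strict Implicit.
Unset Printing Implicit Defensive.
Import Order.TTheory GRing.Theory Num.Def Num.Theory.
Import numFieldNormedType.Exports.
Local Open Scope classical_set_scope.
Local Open Scope ring_scope.

(* The two scalar fields of analysis, R and R[i], treated uniformly: a field with
   real and imaginary parts. Only [real_scalar] and [complex_scalar] below are
   meant to be used. *)
Record scalarField (R : realType) := ScalarField {
  scalar_sort :> numFieldType;
  re : scalar_sort -> R;
  im : scalar_sort -> R;
  ofR : {rmorphism R -> scalar_sort};
  reD : {morph re : x y / x + y};
  imD : {morph im : x y / x + y};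
  reM : forall x y, re (x * y) = re x * re y - im x * im y;
  imM : forall x y, im (x * y) = re x * im y + im x * re y;
  re_ofR : cancel ofR re;
  ler_ofR : {mono ofR : x y / x <= y};
  normE : forall x, `|x| = ofR (Num.sqrt (re x ^+ 2 + im x ^+ 2)) }.

Section instances.
Variable R : realType.

Definition real_scalar : scalarField R.
Proof.
refine (@ScalarField R R id (fun=> 0) idfun _ _ _ _ _ _ _) => //.
- by move=> x y; rewrite addr0.
- by move=> x y; rewrite mulr0 subr0.
- by move=> x y; rewrite mulr0 mul0r addr0.
- by move=> x; rewrite expr0n /= addr0 sqrtr_sqr.
Defined.

Definition complex_scalar : scalarField R.
Proof.
refine (@ScalarField R R[i] (@complex.Re R) (@complex.Im R) (real_complex R)
  _ _ _ _ _ _ _) => //.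
- by move=> [a b] [c d].
- by move=> [a b] [c d].
- by move=> [a b] [c d].
- by move=> [a b] [c d].
- by move=> x y; rewrite lecR.
- by move=> [a b]; rewrite normc_def.
Defined.

End instances.

Section scalar_theory.
Context {R : realType} {K : scalarField R}.

(* In a normed module over K the norm takes its values in K; [rnorm] is the same
   norm seen as an element of R. *)
Definition rnorm {V : normedZmodType K} (v : V) : R := re `|v|.

Lemma norm_rnorm (V : normedZmodType K) (v : V) : `|v| = ofR K (rnorm v).
Proof. by rewrite /rnorm -(normr_id v) normE re_ofR. Qed.

Lemma rnorm_ge0 (V : normedZmodType K) (v : V) : 0 <= rnorm v.
Proof. by rewrite -(ler_ofR K) rmorph0 -norm_rnorm. Qed.

Lemma rnorm_le (V W : normedZmodType K) (v : V) (w : W) :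
  (`|v| <= `|w|) = (rnorm v <= rnorm w).
Proof. by rewrite !norm_rnorm ler_ofR. Qed.

Lemma ler_rnormD (V : normedZmodType K) (v w : V) :
  rnorm (v + w) <= rnorm v + rnorm w.
Proof. by rewrite -(ler_ofR K) rmorphD -!norm_rnorm ler_normD. Qed.

Lemma rnorm0_eq0 (V : normedZmodType K) (v : V) : rnorm v = 0 -> v = 0.
Proof. by move=> v0; apply/normr0_eq0; rewrite norm_rnorm v0 rmorph0. Qed.

Lemma rnormZ (V : normedModType K) (a : K) (v : V) :
  rnorm (a *: v) = rnorm a * rnorm v.
Proof. by apply: (can_inj (@re_ofR _ K)); rewrite rmorphM -!norm_rnorm normrZ. Qed.

Lemma rnorm_scalar (x : K) : rnorm x = Num.sqrt (re x ^+ 2 + im x ^+ 2).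
Proof. by rewrite /rnorm normE re_ofR. Qed.

Lemma rnorm_ofR (x : R) : 0 <= x -> rnorm (ofR K x) = x.
Proof. by move=> x0; rewrite /rnorm ger0_norm ?re_ofR// -(rmorph0 (ofR K)) ler_ofR. Qed.

End scalar_theory.

Section dual.
Context {R : realType} {K : scalarField R} {V : normedModType K}.

Definition dual_pred : {pred V -> K^o} :=
  mem [set phi : V -> K^o | linear phi /\ continuous phi].

Fact dual_submod_closed : submod_closed dual_pred.
Proof.
split.
- by rewrite inE; split; [move=> a x y; rewrite scaler0 addr0|exact: cst_continuous].
move=> a f g; rewrite !inE => -[lf cf] [lg cg]; split.
- move=> b x y; rewrite -![(a *: f + g) _]/(a *: f _ + g _) lf lg.
  by rewrite !scalerDr !scalerA mulrC addrACA.
- move=> x; apply: cvgD; last exact: cg.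
  apply: cvgZ; [exact: cvg_cst|exact: cf].
Qed.

HB.instance Definition _ :=
  GRing.isSubmodClosed.Build K (V -> K^o) dual_pred
   (GRing.submod_closed_semi dual_submod_closed).

(* The topological dual, normed below by the operator norm [dual_norm]. *)
Record dual_space := Dual { dual_fun :> V -> K^o; _ : dual_fun \in dual_pred }.

HB.instance Definition _ := [isSub for dual_fun].
HB.instance Definition _ := [Choice of dual_space by <:].
HB.instance Definition _ := [SubChoice_isSubLmodule of dual_space by <:].

Implicit Types phi psi : dual_space.

Lemma dualP phi : linear phi /\ continuous phi.
Proof. by case: phi => f /=; rewrite inE. Qed.

Lemma dualE a phi psi x : (a *: phi + psi) x = a *: phi x + psi x.
Proof. by []. Qed.

Lemma dualZr phi a x : phi (a *: x) = a *: phi x.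
Proof.
have [lf _] := dualP phi.
have f0 : phi 0 = 0.
  by have := lf (-1) 0 0; rewrite !scaleN1r !addNr.
by have := lf a x 0; rewrite f0 !addr0.
Qed.

Definition dual_norm phi : R :=
  sup [set rnorm (phi x) | x in [set x : V | rnorm x <= 1]].

Lemma dual_bounded phi : exists M : R, forall x, rnorm (phi x) <= M * rnorm x.
Proof.
have [lf cf] := dualP phi.
pose F : {linear V -> K^o} :=
  HB.pack (phi : V -> K^o) (@GRing.isLinear.Build _ _ _ _ (phi : V -> K^o) lf).
have /linear_boundedP/pinfty_ex_gt0[M M0 HM] : bounded_near F (nbhs (0 : V)).
  by apply: continuous_linear_bounded; exact: cf.
exists (rnorm M) => x; rewrite -(ler_ofR K) rmorphM -!norm_rnorm.
by rewrite (gtr0_norm M0); exact: HM.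
Qed.

Lemma dual_has_sup phi :
  has_sup [set rnorm (phi x) | x in [set x : V | rnorm x <= 1]].
Proof.
split.
  exists (rnorm (phi 0)), 0 => //=.
  by rewrite /rnorm normr0 -(rmorph0 (ofR K)) re_ofR.
have [M HM] := dual_bounded phi; exists (Num.max M 0) => _ [x /= x1 <-].
apply: (le_trans (HM x)); apply: (@le_trans _ _ (Num.max M 0 * rnorm x)).
  by rewrite ler_wpM2r ?rnorm_ge0// le_max lexx.
by rewrite ler_piMr// le_max lexx orbT.
Qed.

Lemma ler_dual_norm phi x : rnorm (phi x) <= dual_norm phi * rnorm x.
Proof.
have [x0|] := eqVneq (rnorm x) 0.
  have [M HM] := dual_bounded phi.
  by have := HM x; rewrite x0 !mulr0.
move=> xn0; have xp : 0 < rnorm x by rewrite lt_def xn0 rnorm_ge0.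
pose c := ofR K (rnorm x)^-1.
have rc : rnorm c = (rnorm x)^-1 by rewrite rnorm_ofR// invr_ge0 ltW.
rewrite -ler_pdivrMr//.
have -> : rnorm (phi x) / rnorm x = rnorm (phi (c *: x)).
  by rewrite dualZr rnormZ rc mulrC.
apply: sup_upper_bound; first exact: dual_has_sup.
by exists (c *: x) => //=; rewrite rnormZ rc mulVf.
Qed.

Lemma dual_norm_le phi (M : R) :
  (forall x, rnorm x <= 1 -> rnorm (phi x) <= M) -> dual_norm phi <= M.
Proof.
move=> H; apply: ge_sup; first by case: (dual_has_sup phi).
by move=> _ [x /= x1 <-]; exact: H.
Qed.

Lemma dual_norm_ge0 phi : 0 <= dual_norm phi.
Proof.
apply: (le_trans (rnorm_ge0 (phi 0))).
apply: sup_upper_bound; first exact: dual_has_sup.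
by exists 0 => //=; rewrite /rnorm normr0 -(rmorph0 (ofR K)) re_ofR.
Qed.

Let nrm phi : K := ofR K (dual_norm phi).

Let nrmD phi psi : nrm (phi + psi) <= nrm phi + nrm psi.
Proof.
rewrite /nrm -rmorphD ler_ofR; apply: dual_norm_le => x x1.
apply: (le_trans (ler_rnormD _ _)); apply: lerD.
  by apply: (le_trans (ler_dual_norm _ _)); rewrite ler_piMr ?dual_norm_ge0.
by apply: (le_trans (ler_dual_norm _ _)); rewrite ler_piMr ?dual_norm_ge0.
Qed.

Let leZ (a : K) phi : dual_norm (a *: phi) <= rnorm a * dual_norm phi.
Proof.
apply: dual_norm_le => x x1; rewrite [(a *: phi) x]/(a *: phi x) rnormZ.
rewrite ler_wpM2l ?rnorm_ge0//.
by apply: (le_trans (ler_dual_norm _ _)); rewrite ler_piMr ?dual_norm_ge0.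
Qed.

Let nrmZ (a : K) phi : nrm (a *: phi) = `|a| * nrm phi.
Proof.
rewrite norm_rnorm /nrm -rmorphM; congr (ofR K _).
apply/eqP; rewrite eq_le leZ /=.
have [->|a0] := eqVneq a 0.
  by rewrite {1}/rnorm normr0 -(rmorph0 (ofR K)) re_ofR mul0r dual_norm_ge0.
have ra : 0 < rnorm a.
  rewrite lt_def rnorm_ge0 andbT; apply: contra a0 => /eqP.
  by move/rnorm0_eq0 => ->.
rewrite mulrC -ler_pdivlMr// mulrC -{1}(scale1r phi) -(mulVf a0) -scalerA.
apply: (le_trans (leZ _ _)); rewrite ler_wpM2r ?dual_norm_ge0//.
have : rnorm (a^-1 * a) = rnorm a^-1 * rnorm a by exact: (@rnormZ _ _ K^o).
rewrite mulVf// {1}/rnorm normr1 -(rmorph1 (ofR K)) re_ofR => E.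
by rewrite -(mulfK (lt0r_neq0 ra) (rnorm a^-1)) -E mul1r.
Qed.

Let nrm0 phi : nrm phi = 0 -> phi = 0.
Proof.
move=> p0; apply/val_inj/funext => x /=; apply/rnorm0_eq0/eqP.
rewrite eq_le rnorm_ge0 andbT (le_trans (ler_dual_norm _ _))//.
have -> : dual_norm phi = 0 by rewrite -[LHS](@re_ofR _ K) [ofR K _]p0 -(rmorph0 (ofR K)) re_ofR.
by rewrite mul0r.
Qed.

HB.instance Definition _ := @Lmodule_isNormed.Build K dual_space nrm nrmD nrmZ nrm0.

Lemma dual_normE phi : `|phi| = ofR K (dual_norm phi).
Proof. by []. Qed.

End dual.
Arguments dual_space {R K} V.
Arguments Dual {R K V}.

Section bidual.
Context {R : realType} {K : scalarField R} {V : normedModType K}.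

Fact bidual_eval_subproof (v : V) :
  (fun phi : dual_space V => phi v) \in @dual_pred _ _ (dual_space V).
Proof.
rewrite inE; split=> //.
pose F : {linear dual_space V -> K^o} := HB.pack (fun phi : dual_space V => phi v : K^o)
  (@GRing.isLinear.Build K (dual_space V) K^o _ (fun phi : dual_space V => phi v : K^o)
    (fun a phi psi => erefl)).
apply: (@bounded_linear_continuous _ _ _ F).
apply/linear_boundedP; near=> M => phi.
apply: (@le_trans _ _ (`|v| * `|phi|)); last first.
  by rewrite ler_wpM2r//; near: M; exact: nbhs_pinfty_ge.
rewrite norm_rnorm (norm_rnorm v) dual_normE -rmorphM ler_ofR mulrC.
exact: ler_dual_norm.
Unshelve. all: by end_near. Qed.

Definition bidual_eval (v : V) : dual_space (dual_space V) := Dual _ (bidual_eval_subproof v).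

End bidual.

(* The canonical embedding into the bidual is onto. *)
Definition reflexive_space {R : realType} {K : scalarField R}
    (V : normedModType K) : Prop :=
  forall Phi : dual_space (dual_space V), exists v : V, Phi = bidual_eval v.

(* The normed space attached to a seminorm N: the quotient by [N (x - y) = 0]. *)
Record seminorm (K : numFieldType) (V : lmodType K) := Seminorm {
  seminorm_fun :> V -> K;
  seminormD : forall x y, seminorm_fun (x + y) <= seminorm_fun x + seminorm_fun y;
  seminormZ : forall a x, seminorm_fun (a *: x) = `|a| * seminorm_fun x }.

Section seminorm_quotient.
Context {K : numFieldType} {V : lmodType K} (N : seminorm V).
Local Open Scope quotient_scope.

Let N0 : N 0 = 0.
Proof. by rewrite -[in LHS](scale0r 0) seminormZ normr0 mul0r. Qed.

Let NN x : N (- x) = N x.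
Proof. by rewrite -scaleN1r seminormZ normrN1 mul1r. Qed.

Let N_ge0 x : 0 <= N x.
Proof.
have := seminormD N x (- x); rewrite subrr N0 NN -mulr2n -mulr_natl.
by rewrite pmulr_rge0.
Qed.

Definition seminorm_eq (x y : V) := N (x - y) == 0.

Let seminorm_eqxx : reflexive seminorm_eq.
Proof. by move=> x; rewrite /seminorm_eq subrr N0. Qed.

Let seminorm_eqC : symmetric seminorm_eq.
Proof. by move=> x y; rewrite /seminorm_eq -NN opprB. Qed.

Let seminorm_eq_add x y z t :
  seminorm_eq x y -> seminorm_eq z t -> seminorm_eq (x + z) (y + t).
Proof.
rewrite /seminorm_eq => /eqP xy /eqP zt.
rewrite eq_le N_ge0 andbT opprD addrACA (le_trans (seminormD _ _ _))//.
by rewrite xy zt addr0.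
Qed.

Let seminorm_eq_trans : transitive seminorm_eq.
Proof.
move=> y x z xy yz; have := seminorm_eq_add xy yz.
by rewrite /seminorm_eq addrKA.
Qed.

Canonical seminorm_eq_equiv :=
  EquivRel seminorm_eq seminorm_eqxx seminorm_eqC seminorm_eq_trans.

Definition seminorm_quot : Type := {eq_quot seminorm_eq}.
HB.instance Definition _ := Choice.on seminorm_quot.
HB.instance Definition _ := EqQuotient.on seminorm_quot.

Local Notation Q := seminorm_quot.
Implicit Types u v w : Q.

Let zeroq : Q := \pi_Q 0.
Let addq u v : Q := \pi_Q (repr u + repr v).
Let oppq u : Q := \pi_Q (- repr u).
Let scaleq (a : K) u : Q := \pi_Q (a *: repr u).
Let normq u : K := N (repr u).

Let piP x y : reflect (\pi_Q x = \pi_Q y) (seminorm_eq x y).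
Proof. by apply: (iffP idP) => [xy|/eqP]; [apply/eqP|]; rewrite eqmodE. Qed.

Let reprE x : seminorm_eq (repr (\pi_Q x)) x.
Proof. by apply/piP; rewrite reprK. Qed.

Let seminorm_eqZ a x y : seminorm_eq x y -> seminorm_eq (a *: x) (a *: y).
Proof.
by rewrite /seminorm_eq -scalerBr seminormZ => /eqP ->; rewrite mulr0.
Qed.

Let piD x y : addq (\pi_Q x) (\pi_Q y) = \pi_Q (x + y).
Proof. by apply/piP/seminorm_eq_add; exact: reprE. Qed.

Let piZ a x : scaleq a (\pi_Q x) = \pi_Q (a *: x).
Proof. by apply/piP/seminorm_eqZ; exact: reprE. Qed.

Let piN x : oppq (\pi_Q x) = \pi_Q (- x).
Proof. by apply/piP; rewrite -scaleN1r -(scaleN1r x); exact/seminorm_eqZ/reprE. Qed.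

Let pi_norm x : normq (\pi_Q x) = N x.
Proof.
have le y z : seminorm_eq y z -> N y <= N z.
  move=> /eqP yz; rewrite -(subrK z y) (le_trans (seminormD _ _ _))//.
  by rewrite yz add0r.
by apply/eqP; rewrite eq_le !le ?reprE// seminorm_eqC reprE.
Qed.

Let addqA : associative addq.
Proof. move=> u v w; elim/quotW: u => u; elim/quotW: v => v; elim/quotW: w => w.
 by rewrite (piD v w) (piD u) (piD u v) piD addrA.
Qed.
Let addqC : commutative addq.
Proof. move=> u v; elim/quotW: u => u; elim/quotW: v => v.
by rewrite piD (piD v) addrC. Qed.
Let add0q : left_id zeroq addq.
Proof. by move=> u; elim/quotW: u => u; rewrite piD add0r. Qed.
Let addNq : left_inverse zeroq oppq addq.
Proof. by move=> u; elim/quotW: u => u; rewrite piN piD addNr. Qed.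

HB.instance Definition _ := GRing.isZmodule.Build Q addqA addqC add0q addNq.

Let scaleqA a b u : scaleq a (scaleq b u) = scaleq (a * b) u.
Proof. by elim/quotW: u => u; rewrite (piZ b) !(piZ _ u) (piZ a) scalerA. Qed.
Let scale1q : left_id 1 scaleq.
Proof. by move=> u; elim/quotW: u => u; rewrite piZ scale1r. Qed.
Let scaleqDr : right_distributive scaleq +%R.
Proof.
move=> a u v; elim/quotW: u => u; elim/quotW: v => v.
by rewrite [X in scaleq _ X]piD (piZ a u) (piZ a v) (piZ a (u + v)) [RHS]piD scalerDr.
Qed.
Let scaleqDl u : {morph scaleq^~ u : a b / a + b}.
Proof. by elim/quotW: u => u a b; rewrite (piZ a u) (piZ b u) piZ [RHS]piD scalerDl. Qed.

HB.instance Definition _ :=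
  GRing.Zmodule_isLmodule.Build K Q scaleqA scale1q scaleqDr scaleqDl.

Let ler_normqD u v : normq (u + v) <= normq u + normq v.
Proof.
elim/quotW: u => u; elim/quotW: v => v.
by rewrite [X in normq X]piD !pi_norm seminormD.
Qed.
Let normqZ a u : normq (a *: u) = `|a| * normq u.
Proof. by elim/quotW: u => u; rewrite [X in normq X]piZ !pi_norm seminormZ. Qed.
Let normq0_eq0 u : normq u = 0 -> u = 0.
Proof.
elim/quotW: u => u; rewrite pi_norm => u0; apply/piP.
by rewrite /seminorm_eq subr0 u0.
Qed.

HB.instance Definition _ :=
  @Lmodule_isNormed.Build K Q normq ler_normqD normqZ normq0_eq0.

Lemma norm_seminorm_quot (x : V) : `|\pi_Q x : Q| = N x.
Proof. exact: pi_norm. Qed.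

Lemma seminorm_quotD (x y : V) : \pi_Q (x + y) = (\pi_Q x + \pi_Q y : Q).
Proof. exact/esym/piD. Qed.

Lemma seminorm_quotZ a (x : V) : \pi_Q (a *: x) = (a *: \pi_Q x : Q).
Proof. exact/esym/piZ. Qed.

End seminorm_quotient.

Section minkowski_abstract.
Context {R : realType}.
Local Open Scope ereal_scope.

Lemma poweR_conv (r s t : R) (x y : \bar R) : (1 <= r)%R -> (0 < s)%R -> (0 < t)%R ->
  0 <= x -> 0 <= y ->
  (x + y) `^ r <=
   ((s + t) `^ r * (s / (s + t)) / s `^ r)%:E * x `^ r +
   ((s + t) `^ r * (t / (s + t)) / t `^ r)%:E * y `^ r.
Proof.
move=> r1 s0 t0; have r0 : (0 < r)%R by rewrite (lt_le_trans _ r1).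
have st : (0 < s + t)%R by rewrite addr_gt0.
have c1 (u v : R) : (0 < u)%R -> (0 < v)%R -> (0 < (u + v) `^ r * (u / (u + v)) / u `^ r)%R.
  by move=> u0 v0; rewrite !(divr_gt0, mulr_gt0) ?powR_gt0 ?addr_gt0.
have c1' := c1 _ _ t0 s0; rewrite (addrC t) in c1'.
move: x y => [x||] [y||] //= x0 y0; last 3 first.
- by rewrite (gt_eqF r0) gt0_muley ?lte_fin ?c1// addey// -EFinM.
- by rewrite (gt_eqF r0) gt0_muley ?lte_fin ?c1// addye// -EFinM.
- by rewrite (gt_eqF r0) !gt0_muley ?lte_fin ?c1.
rewrite -!EFinM -EFinD lee_fin; rewrite !lee_fin in x0 y0.
have h0 : (0 <= s / (s + t))%R by rewrite divr_ge0 ?ltW.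
have h1 : (s / (s + t) <= 1)%R by rewrite ler_pdivrMr// mul1r lerDl ltW.
have := @convex_powR R r r1 (Itv01 h0 h1) (x / s)%R (y / t)%R.
rewrite !inE /= !in_itv/= !andbT !divr_ge0 ?(ltW s0) ?(ltW t0)// => /(_ isT isT).
rewrite [X in (X `^ _ <= _)%R -> _]convRE !convRE /= /unstable.onem. 
have -> : (1 - s / (s + t) = t / (s + t))%R by field; rewrite gt_eqF.
have -> : (s / (s + t) * (x / s) + t / (s + t) * (y / t) = (x + y) / (s + t))%R.
  by field; rewrite !gt_eqF.
have pdiv (u v : R) : (0 <= u)%R -> (0 < v)%R -> ((u / v) `^ r = u `^ r / v `^ r)%R.
  move=> u0 v0; rewrite powRM ?invr_ge0 ?(ltW v0)//; congr *%R.
  by rewrite -(powR_inv1 (ltW v0)) powRAC powR_inv1 ?powR_ge0.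
rewrite !pdiv ?addr_ge0// ler_pdivrMr ?powR_gt0// => /le_trans; apply.
by rewrite le_eqVlt; apply/orP; left; apply/eqP; ring.
Qed.

Lemma abstract_minkowski (X : Type) (I : (X -> \bar R) -> \bar R)
    (P : (X -> \bar R) -> Prop) (r : R) (f g : X -> \bar R) :
  (1 <= r)%R ->
  (forall f g, P f -> P g -> (forall x, 0 <= f x) -> (forall x, f x <= g x) -> I f <= I g) ->
  (forall f, P f -> (forall x, 0 <= f x) -> 0 <= I f) ->
  (forall k l f g, (0 <= k)%R -> (0 <= l)%R -> P f -> P g ->
     (forall x, 0 <= f x) -> (forall x, 0 <= g x) ->
     I (fun x => k%:E * f x + l%:E * g x) = k%:E * I f + l%:E * I g) ->
  (forall k l f g, P f -> P g -> P (fun x => k%:E * f x + l%:E * g x)) ->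
  (forall x, 0 <= f x) -> (forall x, 0 <= g x) ->
  P (fun x => f x `^ r) -> P (fun x => g x `^ r) ->
  P (fun x => (f x + g x) `^ r) ->
  I (fun x => (f x + g x) `^ r) `^ r^-1 <=
    I (fun x => f x `^ r) `^ r^-1 + I (fun x => g x `^ r) `^ r^-1.
Proof.
move=> r1 Ile I0 Ilin Plin f0 g0 Pf Pg Pfg.
have r0 : (0 < r)%R by rewrite (lt_le_trans _ r1).
set A := I (fun x => f x `^ r); set B := I (fun x => g x `^ r).
have [->|Aoo] := eqVneq (A `^ r^-1) +oo.
  by rewrite addye ?leey// -ltNye (lt_le_trans _ (poweR_ge0 _ _)).
have [->|Boo] := eqVneq (B `^ r^-1) +oo.
  by rewrite addey ?leey// -ltNye (lt_le_trans _ (poweR_ge0 _ _)).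
have fin (c : \bar R) : 0 <= c -> c != +oo -> c \is a fin_num.
  by move=> c0 coo; rewrite ge0_fin_numE// ltey.
have A0 : 0 <= A by apply: I0 => // x; exact: poweR_ge0.
have B0 : 0 <= B by apply: I0 => // x; exact: poweR_ge0.
pose a := fine (A `^ r^-1); pose b := fine (B `^ r^-1).
have aE : A `^ r^-1 = a%:E by rewrite fineK// fin// poweR_ge0.
have bE : B `^ r^-1 = b%:E by rewrite fineK// fin// poweR_ge0.
have a0 : (0 <= a)%R by rewrite -lee_fin -aE poweR_ge0.
have b0 : (0 <= b)%R by rewrite -lee_fin -bE poweR_ge0.
have AE : A = (a `^ r)%:E.
  by rewrite -poweR_EFin -aE -poweRrM mulVf ?gt_eqF// poweRe1.
have BE : B = (b `^ r)%:E.
  by rewrite -poweR_EFin -bE -poweRrM mulVf ?gt_eqF// poweRe1.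
rewrite aE bE; apply/lee_addgt0Pr => e e0.
pose s := (a + e / 2)%R; pose t := (b + e / 2)%R.
have s0 : (0 < s)%R by rewrite ltr_wpDl// divr_gt0.
have t0 : (0 < t)%R by rewrite ltr_wpDl// divr_gt0.
have -> : a%:E + b%:E + e%:E = (s + t)%:E.
  by rewrite -!EFinD; congr EFin; rewrite /s /t; field.
have st : (0 < s + t)%R by rewrite addr_gt0.
suff H : I (fun x => (f x + g x) `^ r) <= ((s + t) `^ r)%:E.
  have -> : (s + t)%:E = ((s + t) `^ r)%:E `^ r^-1.
    by rewrite -poweR_EFin -poweRrM divff ?gt_eqF// poweRe1// lee_fin ltW.
  apply: gt0_ler_poweR => //.
  - by rewrite invr_ge0 ltW.
  - by rewrite in_itv/= leey andbT; apply: I0 => // x; exact: poweR_ge0.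
  - by rewrite in_itv/= leey andbT lee_fin powR_ge0.
pose k := ((s + t) `^ r * (s / (s + t)) / s `^ r)%R.
pose l := ((s + t) `^ r * (t / (s + t)) / t `^ r)%R.
have k0 : (0 <= k)%R by rewrite !(divr_ge0, mulr_ge0) ?powR_ge0 ?(ltW s0) ?(ltW st).
have l0 : (0 <= l)%R by rewrite !(divr_ge0, mulr_ge0) ?powR_ge0 ?(ltW t0) ?(ltW st).
apply: (@le_trans _ _ (I (fun x => k%:E * f x `^ r + l%:E * g x `^ r))).
  apply: Ile => //; [exact: Plin|by move=> x; exact: poweR_ge0|].
  by move=> x; exact: poweR_conv.
rewrite Ilin//; [|by move=> x; exact: poweR_ge0..].
rewrite -/A -/B AE BE -!EFinM -EFinD lee_fin.
apply: (@le_trans _ _ (k * s `^ r + l * t `^ r)%R).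
  apply: lerD; apply: ler_wpM2l => //; apply: ge0_ler_powR; rewrite ?nnegrE ?(ltW r0) ?(ltW s0) ?(ltW t0)//.
    by rewrite lerDl divr_ge0// ltW.
  by rewrite lerDl divr_ge0// ltW.
rewrite /k /l !divfK ?gt_eqF ?powR_gt0// -mulrDr -mulrDl divff ?gt_eqF//.
by rewrite mulr1.
Qed.

End minkowski_abstract.

Section mixed_norm.
Context {R : realType}.
Local Open Scope ereal_scope.
Local Notation mu := (@lebesgue_measure R).

(* For a tuple (x_1, ..., x_n) the head x_1 is integrated first:
   (\int ... (\int |f|^p_1 dx_1)^(p_2/p_1) ... dx_n)^(1/p_n) is the iteration of the
   one-dimensional norms L^p_1(dx_1), ..., L^p_n(dx_n). *)
Fixpoint mixed_norm n : n.-tuple R -> (n.-tuple R -> \bar R) -> \bar R :=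
  match n with
  | 0 => fun _ f => `|f [tuple]|
  | n'.+1 => fun p f =>
      mixed_norm [tuple of behead p]
        (fun y : n'.-tuple R => 'N[mu]_(thead p)%:E[(fun x : R => f [tuple of x :: y])])
  end.

Let sect n (f : n.+1.-tuple R -> \bar R) (p : R) (y : n.-tuple R) :=
  'N[mu]_p%:E[(fun x : R => f [tuple of x :: y])].

Let measurable_consp n :
  measurable_fun [set: R * n.-tuple R] (fun z => [tuple of z.1 :: z.2] : n.+1.-tuple R).
Proof. exact: measurable_cons. Qed.

Let measurable_consl n (y : n.-tuple R) :
  measurable_fun [set: R] (fun x => [tuple of x :: y] : n.+1.-tuple R).
Proof. exact: measurable_cons. Qed.

Let measurable_pow d (T : measurableType d) (f : T -> \bar R) p :
  measurable_fun setT f -> measurable_fun setT (fun x => `|f x| `^ p).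
Proof.
move=> mf; apply: (measurableT_comp (measurable_poweR _)).
exact: measurableT_comp.
Qed.

Let measurable_sect n (f : n.+1.-tuple R -> \bar R) p :
  measurable_fun setT f -> measurable_fun setT (sect f p).
Proof.
move=> mf; rewrite /sect unlock.
apply: (measurableT_comp (measurable_poweR _)).
pose F := fun z : R * n.-tuple R => `|f [tuple of z.1 :: z.2]| `^ p.
apply: (@measurable_fun_fubini_tonelli_G _ _ _ _ _ mu F).
  by apply: measurable_pow; exact: (measurableT_comp mf (@measurable_consp n)).
by move=> z; exact: poweR_ge0.
Qed.

Let measurable_secf n (f : n.+1.-tuple R -> \bar R) (y : n.-tuple R) :
  measurable_fun setT f -> measurable_fun setT (fun x : R => f [tuple of x :: y]).
Proof. by move=> mf; exact: (measurableT_comp mf (@measurable_consl n y)). Qed.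

Lemma le_Lnorm (f g : R -> \bar R) p : (0 <= p)%R ->
  measurable_fun setT f -> measurable_fun setT g ->
  (forall x, 0 <= f x) -> (forall x, f x <= g x) -> 'N[mu]_p%:E[f] <= 'N[mu]_p%:E[g].
Proof.
move=> p0 mf mg f0 fg; rewrite unlock; apply: gt0_ler_poweR.
- by rewrite invr_ge0.
- by rewrite in_itv/= leey integral_ge0// => x _; exact: poweR_ge0.
- by rewrite in_itv/= leey integral_ge0// => x _; exact: poweR_ge0.
apply: ge0_le_integral => //.
- by move=> x _; exact: poweR_ge0.
- exact: measurable_pow.
- by exact: measurable_pow.
- move=> x _; have g0 := le_trans (f0 x) (fg x).
  rewrite !gee0_abs//; apply: gt0_ler_poweR => //; by rewrite in_itv/= leey andbT.
Qed.

Lemma eLnorm_minkowski (f g : R -> \bar R) p : (1 <= p)%R ->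
  measurable_fun setT f -> measurable_fun setT g ->
  (forall x, 0 <= f x) -> (forall x, 0 <= g x) ->
  'N[mu]_p%:E[f \+ g] <= 'N[mu]_p%:E[f] + 'N[mu]_p%:E[g].
Proof.
move=> p1 mf mg f0 g0; rewrite unlock.
have abs (h : R -> \bar R) : (forall x, 0 <= h x) ->
    \int[mu]_x (`|h x| `^ p) = \int[mu]_x (h x `^ p).
  by move=> h0; apply: eq_integral => x _; rewrite gee0_abs.
rewrite !abs//; last by move=> x; rewrite adde_ge0.
have m (h : R -> \bar R) : measurable_fun setT h -> measurable_fun setT (fun x => h x `^ p).
  by move=> mh; exact: (measurableT_comp (measurable_poweR _)).
apply: (@abstract_minkowski _ _ (fun h => \int[mu]_x h x) (measurable_fun setT)) => //.
- by move=> h k mh mk h0 hk; exact: ge0_le_integral.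
- by move=> h mh h0; exact: integral_ge0.
- move=> k l h1 h2 k0 l0 m1 m2 h10 h20.
  rewrite ge0_integralD//=.
  + by rewrite !ge0_integralZl_EFin.
  + by move=> x _; rewrite mule_ge0.
  + exact: measurable_funeM.
  + by move=> x _; rewrite mule_ge0.
  + exact: measurable_funeM.
- by move=> k l h1 h2 m1 m2; apply: emeasurable_funD; exact: measurable_funeM.
- exact: m.
- exact: m.
- by apply: m; exact: emeasurable_funD.
Qed.

Lemma LnormZl (f : R -> \bar R) p k : (0 < p)%R -> (0 <= k)%R ->
  measurable_fun setT f -> (forall x, 0 <= f x) ->
  'N[mu]_p%:E[(fun x => k%:E * f x)] = k%:E * 'N[mu]_p%:E[f].
Proof.
move=> p0 k0 mf f0; rewrite unlock.
under eq_integral => x _ do rewrite abseM gee0_abs// poweRM//.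
rewrite poweR_EFin ge0_integralZl_EFin ?powR_ge0//; last 2 first.
- by move=> x _; exact: poweR_ge0.
- exact: measurable_pow.
rewrite poweRM ?lee_fin ?powR_ge0//; last by apply: integral_ge0 => x _; exact: poweR_ge0.
by rewrite -poweR_EFin -poweRrM divff ?gt_eqF// poweRe1.
Qed.

Lemma mixed_norm_ge0 n (p : n.-tuple R) f : 0 <= mixed_norm p f.
Proof. by elim: n p f => [|n IH] p f /=. Qed.

Lemma eq_mixed_norm n (p : n.-tuple R) f g : f =1 g -> mixed_norm p f = mixed_norm p g.
Proof. by move=> /funext ->. Qed.

Lemma le_mixed_norm n (p : n.-tuple R) f g :
  (forall i, 0 <= tnth p i)%R ->
  measurable_fun setT f -> measurable_fun setT g ->
  (forall x, 0 <= f x) -> (forall x, f x <= g x) ->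
  mixed_norm p f <= mixed_norm p g.
Proof.
elim: n p f g => [|n IH] p f g p0 mf mg f0 fg /=.
  by rewrite !gee0_abs// (le_trans (f0 _) (fg _)).
apply: IH.
- by move=> i; rewrite tnth_behead.
- exact: measurable_sect.
- exact: measurable_sect.
- by move=> y; exact: Lnorm_ge0.
- by move=> y; apply: le_Lnorm => //; [exact: (p0 ord0)|exact: measurable_secf..].
Qed.

Lemma mixed_normD n (p : n.-tuple R) f g :
  (forall i, 1 <= tnth p i)%R ->
  measurable_fun setT f -> measurable_fun setT g ->
  (forall x, 0 <= f x) -> (forall x, 0 <= g x) ->
  mixed_norm p (f \+ g) <= mixed_norm p f + mixed_norm p g.
Proof.
elim: n p f g => [|n IH] p f g p1 mf mg f0 g0 /=.
  by rewrite !gee0_abs// adde_ge0.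
have p1' i : (1 <= tnth [tuple of behead p] i)%R by rewrite tnth_behead.
have ms (h : n.+1.-tuple R -> \bar R) (q : R) :
    measurable_fun setT h -> measurable_fun setT (sect h q) by exact: measurable_sect.
apply: le_trans (IH _ (sect f (thead p)) (sect g (thead p)) p1' _ _ _ _);
  last 4 first.
- exact: ms.
- exact: ms.
- by move=> y; exact: Lnorm_ge0.
- by move=> y; exact: Lnorm_ge0.
apply: le_mixed_norm => //.
- by move=> i; rewrite (le_trans _ (p1' i)).
- by apply: (ms (f \+ g)); exact: emeasurable_funD.
- by apply: (emeasurable_funD (f := sect f (thead p)) (g := sect g (thead p))); exact: ms.
- by move=> y; exact: Lnorm_ge0.
- by move=> y; apply: eLnorm_minkowski => //; [exact: (p1 ord0)|exact: measurable_secf..].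
Qed.

Lemma mixed_normZ n (p : n.-tuple R) f k :
  (forall i, 0 < tnth p i)%R -> (0 <= k)%R ->
  measurable_fun setT f -> (forall x, 0 <= f x) ->
  mixed_norm p (fun x => k%:E * f x) = k%:E * mixed_norm p f.
Proof.
elim: n p f => [|n IH] p f p0 k0 mf f0 /=.
  by rewrite abseM gee0_abs.
rewrite -IH//; first last.
- by move=> y; exact: Lnorm_ge0.
- exact: measurable_sect.
- by move=> i; rewrite tnth_behead.
by apply: eq_mixed_norm => y; rewrite LnormZl//; [exact: (p0 ord0)|exact: measurable_secf].
Qed.

End mixed_norm.

Lemma le_esumZ (R : realType) (T : choiceType) (k : R) (a : T -> \bar R) :
  (0 <= k)%R -> (forall i, 0 <= a i)%E ->
  (\esum_(i in setT) (k%:E * a i) <= k%:E * \esum_(i in setT) a i)%E.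
Proof.
move=> k0 a0; apply: ge_ereal_sup => _ [A /= [finA _] <-].
rewrite -ge0_mule_fsumr//.
by apply: lee_wpmul2l => //; apply: ereal_sup_ubound; exists A.
Qed.

Lemma esumZ (R : realType) (T : choiceType) (k : R) (a : T -> \bar R) :
  (0 <= k)%R -> (forall i, 0 <= a i)%E ->
  (\esum_(i in setT) (k%:E * a i) = k%:E * \esum_(i in setT) a i)%E.
Proof.
move=> k0 a0; apply/eqP; rewrite eq_le le_esumZ//=.
have [->|kn0] := eqVneq k 0; first by rewrite mul0e esum_ge0// => i _; rewrite mul0e.
have kp : 0 < k by rewrite lt_def kn0.
have ka0 i : (0 <= k%:E * a i)%E by rewrite mule_ge0.
rewrite -(@lee_pmul2l _ k^-1%:E)//; last by rewrite lte_fin invr_gt0.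
rewrite muleA -EFinM mulVf// mul1e.
have /le_trans : (\esum_(i in setT) a i <=
    \esum_(i in setT) (k^-1%:E * (k%:E * a i)))%E.
  by apply: le_esum => i _; rewrite muleA -EFinM mulVf// mul1e.
by apply; rewrite le_esumZ// invr_ge0.
Qed.

Section bourgain_morrey.
Context {R : realType} (K : scalarField R) {n : nat}.
Implicit Types (p : n.-tuple R) (t r : R) (f g : n.-tuple R -> K^o).

(* n.-tuple R carries the product (Borel) sigma-algebra. Working with Borel functions
   loses nothing: a Lebesgue measurable function is a.e. equal to a Borel one, and
   a.e. equal functions are identified in [mixedBM]. *)
Definition measurable_scalar f :=
  measurable_fun setT (@re R K \o f) /\ measurable_fun setT (@im R K \o f).

Definition mixed_Lnorm p f : \bar R := mixed_norm p (fun x => (rnorm (f x))%:E).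

Definition dyadic_cube (j : int) (k : n.-tuple int) : set (n.-tuple R) :=
  [set x | forall i,
    2 ^ (- j) * (tnth k i)%:~R <= tnth x i < 2 ^ (- j) * (tnth k i + 1)%:~R].

Definition dyadic_volume (j : int) : R := (2 ^ (- j)) ^+ n.

Definition BMexponent p t r : R := r / t - r / n%:R * \sum_(i < n) (tnth p i)^-1.

(* (j, k) |-> Q_{j,k} is injective when 0 < n, so summing over the indices is summing
   over the dyadic cubes; [f x *+ (x \in Q)] is the product of f by the indicator of Q. *)
Definition BMnorm p t r f : \bar R :=
  ((\esum_(q in [set: int * n.-tuple int])
     ((dyadic_volume q.1 `^ BMexponent p t r)%:E *
      mixed_Lnorm p (fun x => f x *+ (x \in dyadic_cube q.1 q.2))%R `^ r)) `^ r^-1)%E.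

Lemma measurable_dyadic_cube j k : measurable (dyadic_cube j k).
Proof.
have -> : dyadic_cube j k = \bigcap_(i in [set: 'I_n])
    ((fun x : n.-tuple R => tnth x i) @^-1`
      [set` `[2 ^ (- j) * (tnth k i)%:~R, 2 ^ (- j) * (tnth k i + 1)%:~R[ ]).
  apply/seteqP; split=> x /= H i; first by move=> _ /=; rewrite in_itv/= H.
  by have := H i I; rewrite /= in_itv.
apply: fin_bigcap_measurable => [|i _]; first exact: finite_finset.
rewrite -[X in measurable X]setTI.
by apply: measurable_tnth => //; exact: measurable_itv.
Qed.

Lemma measurable_rnorm f : measurable_scalar f ->
  measurable_fun setT (fun x => rnorm (f x)).
Proof.
move=> [mre mim]; rewrite (_ : (fun x => _) =
    (fun x => Num.sqrt (re (f x) ^+ 2 + im (f x) ^+ 2))); last first.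
  by apply/funext => x; rewrite rnorm_scalar.
apply: (@measurableT_comp _ _ _ _ _ _ (@Num.sqrt R)).
  apply: continuous_measurable_fun. exact: sqrt_continuous.
by apply: measurable_funD; apply: measurable_funX.
Qed.

Lemma measurable_scalarD f g :
  measurable_scalar f -> measurable_scalar g -> measurable_scalar (f + g).
Proof.
move=> [f1 f2] [g1 g2]; split.
  rewrite (_ : _ \o _ = (@re R K \o f) \+ (@re R K \o g)); first exact: measurable_funD.
  by apply/funext => x /=; rewrite reD.
rewrite (_ : _ \o _ = (@im R K \o f) \+ (@im R K \o g)); first exact: measurable_funD.
by apply/funext => x /=; rewrite imD.
Qed.

Lemma measurable_scalarZ (a : K) f :
  measurable_scalar f -> measurable_scalar (a *: f).
Proof.
move=> [f1 f2]; split.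
  rewrite (_ : _ \o _ = (fun x => re a * re (f x) - im a * im (f x))).
    by apply: measurable_funB; exact: measurable_funM.
  by apply/funext => x /=; rewrite -reM.
rewrite (_ : _ \o _ = (fun x => re a * im (f x) + im a * re (f x))).
  by apply: measurable_funD; exact: measurable_funM.
by apply/funext => x /=; rewrite -imM.
Qed.

Lemma measurable_scalar_indic f (Q : set (n.-tuple R)) : measurable Q ->
  measurable_scalar f -> measurable_scalar (fun x => f x *+ (x \in Q)).
Proof.
move=> mQ [f1 f2].
have s0 (s : K -> R) : {morph s : x y / x + y} -> s 0 = 0.
  by move=> sD; apply: (addrI (s 0)); rewrite -sD !addr0.
split.
  rewrite (_ : _ \o _ = (@re R K \o f) \* (\1_Q)).
    by apply: measurable_funM => //; exact: measurable_indic.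
  apply/funext => x /=; rewrite indicE.
  by case: (_ \in _); rewrite ?mulr1 ?mulr0// s0//; exact: reD.
rewrite (_ : _ \o _ = (@im R K \o f) \* (\1_Q)).
  by apply: measurable_funM => //; exact: measurable_indic.
apply/funext => x /=; rewrite indicE.
by case: (_ \in _); rewrite ?mulr1 ?mulr0// s0//; exact: imD.
Qed.

Section mixed_Lnorm_theory.
Variable p : n.-tuple R.
Hypothesis p1 : forall i, 1 <= tnth p i.

Lemma mixed_LnormD f g : measurable_scalar f -> measurable_scalar g ->
  (mixed_Lnorm p (f + g)%R <= mixed_Lnorm p f + mixed_Lnorm p g)%E.
Proof.
move=> mf mg.
have m (h : n.-tuple R -> K^o) : measurable_scalar h ->
    measurable_fun setT (fun x => (rnorm (h x))%:E).
  by move=> mh; apply/measurable_EFinP; exact: measurable_rnorm.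
apply: le_trans (mixed_normD p1 (m _ mf) (m _ mg) _ _); last 2 first.
- by move=> x; rewrite lee_fin rnorm_ge0.
- by move=> x; rewrite lee_fin rnorm_ge0.
apply: le_mixed_norm.
- by move=> i; rewrite (le_trans _ (p1 i)).
- by apply: (m (f + g)); exact: measurable_scalarD.
- by apply: emeasurable_funD; exact: m.
- by move=> x; rewrite lee_fin rnorm_ge0.
- by move=> x; rewrite /= -EFinD lee_fin; exact: ler_rnormD.
Qed.

Lemma mixed_LnormZ (a : K) f : measurable_scalar f ->
  (mixed_Lnorm p (a *: f)%R = (rnorm a)%:E * mixed_Lnorm p f)%E.
Proof.
move=> mf; rewrite -mixed_normZ.
- by apply: eq_mixed_norm => x; rewrite -EFinM -rnormZ.
- by move=> i; rewrite (lt_le_trans _ (p1 i)).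
- exact: rnorm_ge0.
- by apply/measurable_EFinP; exact: measurable_rnorm.
- by move=> x; rewrite lee_fin rnorm_ge0.
Qed.

Variables (t r : R).
Hypothesis r1 : 1 <= r.
Let r0 : 0 < r. Proof. exact: lt_le_trans r1. Qed.

Local Notation BM := (BMnorm p t r).

Lemma BMnorm_ge0 f : (0 <= BM f)%E.
Proof. exact: poweR_ge0. Qed.

Let vol (q : int * n.-tuple int) := dyadic_volume q.1 `^ BMexponent p t r.
Let vol0 q : 0 <= vol q. Proof. exact: powR_ge0. Qed.
Let loc f (q : int * n.-tuple int) :=
  mixed_Lnorm p (fun x => f x *+ (x \in dyadic_cube q.1 q.2)).
Let loc0 f q : (0 <= loc f q)%E. Proof. exact: mixed_norm_ge0. Qed.
Let volloc0 f q : (0 <= (vol q)%:E * loc f q `^ r)%E.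
Proof. by rewrite mule_ge0 ?lee_fin// poweR_ge0. Qed.

Let locD f g q : measurable_scalar f -> measurable_scalar g ->
  (loc (f + g)%R q <= loc f q + loc g q)%E.
Proof.
move=> mf mg; rewrite /loc.
have mQ := measurable_dyadic_cube q.1 q.2.
apply: le_trans (mixed_LnormD (measurable_scalar_indic mQ mf)
                              (measurable_scalar_indic mQ mg)).
rewrite le_eqVlt; apply/orP; left; apply/eqP; congr mixed_Lnorm.
by apply/funext => x /=; rewrite -[RHS]/(_ + _) -mulrnDl.
Qed.

Let locZ (a : K) f q : measurable_scalar f ->
  (loc (a *: f)%R q = (rnorm a)%:E * loc f q)%E.
Proof.
move=> mf; rewrite /loc -mixed_LnormZ.
  by congr mixed_Lnorm; apply/funext => x; rewrite -[RHS]/(_ *: _) scalerMnr.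
by apply: measurable_scalar_indic => //; exact: measurable_dyadic_cube.
Qed.

Lemma BMnormD f g : measurable_scalar f -> measurable_scalar g ->
  (BM (f + g)%R <= BM f + BM g)%E.
Proof.
move=> mf mg.
pose I (h : int * n.-tuple int -> \bar R) := \esum_(q in setT) ((vol q)%:E * h q)%E.
apply: (@le_trans _ _ (I (fun q => (loc f q + loc g q) `^ r)%E `^ r^-1)%E).
  apply: gt0_ler_poweR.
  - by rewrite invr_ge0 ltW.
  - by rewrite in_itv/= leey andbT esum_ge0// => q _; exact: volloc0.
  - rewrite in_itv/= leey andbT esum_ge0// => q _.
    by rewrite mule_ge0 ?lee_fin// poweR_ge0.
  apply: le_esum => q _; apply: lee_wpmul2l; first exact: (vol0 q).
  apply: gt0_ler_poweR; rewrite ?in_itv/= ?leey ?andbT ?adde_ge0 ?loc0 ?(ltW r0)//.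
  exact: locD.
apply: (@abstract_minkowski _ _ I (fun=> True)) => //.
- move=> h k _ _ h0 hk; apply: le_esum => q _.
  by apply: lee_wpmul2l; rewrite ?lee_fin.
- by move=> h _ h0; apply: esum_ge0 => q _; rewrite mule_ge0 ?lee_fin.
- move=> k l h1 h2 k0 l0 _ _ h10 h20; rewrite /I.
  rewrite -!esumZ//; [|by move=> q; rewrite mule_ge0 ?lee_fin..].
  rewrite -esumD; [|by move=> q _; rewrite !mule_ge0 ?lee_fin..].
  apply: eq_esum => q _.
  by rewrite ge0_muleDr ?mule_ge0 ?lee_fin// !muleA ![((vol q)%:E * _)%E]muleC.
Qed.

Lemma BMnormZ (a : K) f : measurable_scalar f ->
  (BM (a *: f)%R = (rnorm a)%:E * BM f)%E.
Proof.
move=> mf; have a0 := rnorm_ge0 (a : K^o).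
transitivity ((\esum_(q in setT)
   ((rnorm (a : K^o) `^ r)%:E * ((vol q)%:E * loc f q `^ r)))%E `^ r^-1)%E.
  congr (_ `^ _)%E; apply: eq_esum => q _.
  by rewrite -/(loc _ q) locZ// poweRM ?lee_fin ?loc0// poweR_EFin muleCA.
rewrite esumZ ?powR_ge0//.
rewrite poweRM ?lee_fin ?powR_ge0//; last by apply: esum_ge0 => q _; exact: volloc0.
by rewrite poweR_EFin -powRrM divff ?gt_eqF// powRr1.
Qed.

End mixed_Lnorm_theory.
End bourgain_morrey.

Section bourgain_morrey_space.
Context {R : realType} (K : scalarField R) {n : nat} {p : n.-tuple R} (t : R) {r : R}.
Variables (p1 : forall i, 1 <= tnth p i) (r1 : 1 <= r).

(* The proofs of [1 <= p_i] and [1 <= r] are parameters because the structures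
   below exist only under these conditions. *)
Definition BM_pred of (forall i, 1 <= tnth p i) & 1 <= r :
    {pred n.-tuple R -> K^o} :=
  mem [set f : n.-tuple R -> K^o | measurable_scalar f /\ (BMnorm p t r f < +oo)%E].

Fact BM_submod_closed : submod_closed (BM_pred p1 r1).
Proof.
split; rewrite ?inE.
  have m0 : measurable_scalar (0 : n.-tuple R -> K^o).
    have s0 (s : K -> R) : {morph s : x y / x + y} -> s 0 = 0.
      by move=> sD; apply: (addrI (s 0)); rewrite -sD !addr0.
    split.
      rewrite (_ : _ \o _ = cst 0); first exact: measurable_cst.
      by apply/funext => x /=; rewrite s0//; exact: reD.
    rewrite (_ : _ \o _ = cst 0); first exact: measurable_cst.
    by apply/funext => x /=; rewrite s0//; exact: imD.
  split=> //; rewrite -(scale0r 0) BMnormZ//.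
  by rewrite /rnorm normr0 -(rmorph0 (ofR K)) re_ofR mul0e.
move=> a f g; rewrite !inE => -[mf Nf] [mg Ng]; split.
  by apply: measurable_scalarD => //; exact: measurable_scalarZ.
apply: (le_lt_trans (BMnormD p1 t r1 (measurable_scalarZ a mf) mg)).
rewrite BMnormZ// lte_add_pinfty// lte_mul_pinfty ?lee_fin ?rnorm_ge0//.
Qed.

HB.instance Definition _ :=
  GRing.isSubmodClosed.Build K (n.-tuple R -> K^o) (BM_pred p1 r1)
   (GRing.submod_closed_semi BM_submod_closed).

Record BMfun := MkBMfun {
  BMfun_val :> n.-tuple R -> K^o;
  _ : BMfun_val \in BM_pred p1 r1 }.

HB.instance Definition _ := [isSub for BMfun_val].
HB.instance Definition _ := [Choice of BMfun by <:].
HB.instance Definition _ := [SubChoice_isSubLmodule of BMfun by <:].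

Lemma BMfunP (f : BMfun) : measurable_scalar f /\ (BMnorm p t r f < +oo)%E.
Proof. by case: f => f /=; rewrite inE. Qed.

Definition BM_seminorm_fun (f : BMfun) : K := ofR K (fine (BMnorm p t r f)).

Lemma BMnorm_fin (f : BMfun) : BMnorm p t r f \is a fin_num.
Proof. by rewrite ge0_fin_numE ?BMnorm_ge0//; case: (BMfunP f). Qed.

Fact BM_seminormD (f g : BMfun) :
  BM_seminorm_fun (f + g) <= BM_seminorm_fun f + BM_seminorm_fun g.
Proof.
rewrite /BM_seminorm_fun -rmorphD ler_ofR -lee_fin EFinD !fineK ?BMnorm_fin//.
by apply: BMnormD => //; case: (BMfunP f) (BMfunP g) => ? _ [].
Qed.

Fact BM_seminormZ a (f : BMfun) :
  BM_seminorm_fun (a *: f) = `|a| * BM_seminorm_fun f.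
Proof.
rewrite /BM_seminorm_fun (norm_rnorm (a : K^o)) -rmorphM; congr (ofR K _).
by apply: EFin_inj; rewrite EFinM !fineK ?BMnorm_fin// BMnormZ//; case: (BMfunP f).
Qed.

Definition BM_seminorm : seminorm BMfun := Seminorm BM_seminormD BM_seminormZ.

(* A function has zero seminorm iff it vanishes a.e., so this quotient consists of the
   classes of a.e. equal functions. *)
Definition mixedBM : normedModType K := seminorm_quot BM_seminorm.

End bourgain_morrey_space.

(* Main.v *)
(* The space is uniformly convex and complete, hence reflexive (Milman-Pettis).

   Uniform convexity: with lsum_s(a, b) = (a^s + b^s)^(1/s), every L^p norm N satisfies
   N(lsum_s(F, G)) <= lsum_s(N F, N G) for s <= p and the reverse inequality for s >= p
   (Minkowski and reverse Minkowski with the exponent p/s). Both survive iteration, so they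
   hold for the mixed Bourgain-Morrey norm with s <= p_i, r in the first case and
   p_i, r <= s in the second. Combined with the pointwise two-point inequality
     |(x + y)/2|^q + (c |x - y|)^q <= ((|x|^s + |y|^s)/2)^(q/s)      (1 < s <= 2 <= q)
   they give the same inequality for norms, which is uniform convexity.

   Completeness: along a sequence with geometrically decreasing steps the sum of the moduli
   of the steps is controlled by monotone convergence through all the layers of the norm.

   Milman-Pettis: if Phi in the bidual has norm 1 and the phi_k almost norm it, the slices of
   the unit ball where phi_k is close to 1 shrink, and by Goldstine's theorem they meet each
   other and every set where a given functional psi is close to Phi(psi); their limit point
   represents Phi. *)
Require Import Defs.
From mathcomp Require Import all_boot all_order all_algebra.
From mathcomp Require Import complex ring lra zify.
From mathcomp Require Import all_classical all_reals all_analysis.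
From mathcomp Require Import measurable_realfun.

Set Implicit Arguments.
Unset Strict Implicit.
Unset Printing Implicit Defensive.
Import Order.TTheory GRing.Theory Num.Def Num.Theory.
Import numFieldNormedType.Exports.
Local Open Scope classical_set_scope.
Local Open Scope ring_scope.

(** * Goldstine and Milman-Pettis theorems *)

Section scalars.
Context {R : realType} {K : scalarField R}.
Implicit Types (x y z : K) (a b : R).

Lemma re0 : re (0 : K) = 0.
Proof. by apply: (addrI (re (0 : K))); rewrite -reD !addr0. Qed.

Lemma im0 : im (0 : K) = 0.
Proof. by apply: (addrI (im (0 : K))); rewrite -imD !addr0. Qed.

Lemma reN x : re (- x) = - re x.
Proof. by apply/eqP; rewrite -addr_eq0 -reD addNr re0. Qed.

Lemma imN x : im (- x) = - im x.
Proof. by apply/eqP; rewrite -addr_eq0 -imD addNr im0. Qed.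

Lemma reB x y : re (x - y) = re x - re y.
Proof. by rewrite reD reN. Qed.

Lemma imB x y : im (x - y) = im x - im y.
Proof. by rewrite imD imN. Qed.

Lemma sqr_rnorm x : rnorm x ^+ 2 = re x ^+ 2 + im x ^+ 2.
Proof. by rewrite rnorm_scalar sqr_sqrtr// addr_ge0 ?sqr_ge0. Qed.

(** For [a >= 0] the modulus of [ofR K a] is already its real part, so the imaginary part
    vanishes. *)
Lemma im_ofR a : im (ofR K a) = 0.
Proof.
wlog a0 : a / 0 <= a.
  move=> h; have [/h//|/ltW a0] := leP 0 a.
  by rewrite -(opprK a) rmorphN imN h ?oppr0// oppr_ge0.
have := sqr_rnorm (ofR K a); rewrite rnorm_ofR// re_ofR => /eqP.
by rewrite -subr_eq0 opprD addrA subrr sub0r oppr_eq0 sqrf_eq0 => /eqP.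
Qed.

Lemma re_ofRM a x : re (ofR K a * x) = a * re x.
Proof. by rewrite reM re_ofR im_ofR mul0r subr0. Qed.

Lemma normr_re_le x : `|re x| <= rnorm x.
Proof.
by rewrite -ler_sqr ?nnegrE ?rnorm_ge0// sqr_rnorm real_normK ?num_real// lerDl sqr_ge0.
Qed.

Lemma normr_im_le x : `|im x| <= rnorm x.
Proof.
by rewrite -ler_sqr ?nnegrE ?rnorm_ge0// sqr_rnorm real_normK ?num_real// lerDr sqr_ge0.
Qed.

Lemma re_le_rnorm x : re x <= rnorm x.
Proof. exact: le_trans (ler_norm _) (normr_re_le x). Qed.

Lemma rnorm_le_reim x : rnorm x <= `|re x| + `|im x|.
Proof.
rewrite -ler_sqr ?nnegrE ?rnorm_ge0 ?addr_ge0// sqr_rnorm sqrrD !real_normK ?num_real//.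
by rewrite [leRHS]addrAC lerDl mulrn_wge0// mulr_ge0.
Qed.

Lemma rnorm_parallelogram x y :
  rnorm (x + y) ^+ 2 + rnorm (x - y) ^+ 2 = 2 * (rnorm x ^+ 2 + rnorm y ^+ 2).
Proof. by rewrite !sqr_rnorm !reD !imD !reN !imN; ring. Qed.

Lemma rnormM x y : rnorm (x * y) = rnorm x * rnorm y.
Proof. exact: (@rnormZ _ _ K^o). Qed.

Lemma rnorm1 : rnorm (1 : K) = 1.
Proof. by rewrite -(rmorph1 (ofR K)) rnorm_ofR. Qed.

Lemma rnormV x : rnorm x^-1 = (rnorm x)^-1.
Proof.
have [->|x0] := eqVneq x 0; last first.
  have nx : rnorm x != 0 by apply: contra x0 => /eqP/rnorm0_eq0 ->.
  by apply: (mulfI nx); rewrite -rnormM !divff// rnorm1.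
by rewrite invr0 -(rmorph0 (ofR K)) rnorm_ofR// invr0.
Qed.

Lemma ex_unimodular x : exists2 a : K, rnorm a = 1 & re (a * x) = rnorm x.
Proof.
have [->|x0] := eqVneq x 0.
  by exists 1; rewrite ?rnorm1// mulr0 re0 -(rmorph0 (ofR K)) rnorm_ofR.
have nx : rnorm x != 0 by apply: contra x0 => /eqP/rnorm0_eq0 ->.
exists (ofR K (rnorm x) * x^-1).
  by rewrite rnormM rnormV rnorm_ofR ?rnorm_ge0// divff.
by rewrite -mulrA mulVf// mulr1 re_ofR.
Qed.

(** Otherwise [a = (x - y)^-1] would give [re 1 = 0]. *)
Lemma scalar_re_inj x y : (forall a : K, re (a * x) = re (a * y)) -> x = y.
Proof.
move=> h; apply/eqP; rewrite -subr_eq0; apply/negP => /negP xy0.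
have := h (x - y)^-1; move/eqP; rewrite -subr_eq0 -reB -mulrBr mulVf//.
by rewrite -(rmorph1 (ofR K)) re_ofR oner_eq0.
Qed.

End scalars.

Section duals.
Context {R : realType} {K : scalarField R} {V : normedModType K}.
Implicit Types (phi psi : dual_space V) (x y : V).

Lemma rnormN x : rnorm (- x) = rnorm x.
Proof. by rewrite /rnorm normrN. Qed.

Lemma rnormB x y : rnorm (x - y) = rnorm (y - x).
Proof. by rewrite -rnormN opprB. Qed.

Lemma dualD phi x y : phi (x + y) = phi x + phi y.
Proof. by have [lf _] := dualP phi; rewrite -[X in phi (X + _)]scale1r lf scale1r. Qed.

Lemma dual0 phi : phi 0 = 0.
Proof. by rewrite -(scale0r 0) dualZr scale0r. Qed.

Lemma dualB phi x y : phi (x - y) = phi x - phi y.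
Proof. by rewrite dualD -scaleN1r dualZr scaleN1r. Qed.

Lemma normr_re_dual_le phi x : `|re (phi x)| <= dual_norm phi * rnorm x.
Proof. exact: le_trans (normr_re_le _) (ler_dual_norm _ _). Qed.

(** Rotating [x] by a unimodular scalar keeps it in the unit ball and turns the modulus of [phi x]
    into a real part. *)
Lemma dual_norm_re_le phi (M : R) :
  (forall x, rnorm x <= 1 -> re (phi x) <= M) -> dual_norm phi <= M.
Proof.
move=> h; apply: dual_norm_le => x x1; have [a a1 <-] := ex_unimodular (phi x : K).
by rewrite -[a * _](dualZr phi a x) h// rnormZ a1 mul1r.
Qed.

Lemma re_dualZD phi psi (a b : R) x :
  re ((ofR K a *: phi + ofR K b *: psi) x) = a * re (phi x) + b * re (psi x).
Proof. by rewrite dualE reD !re_ofRM. Qed.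

Lemma dual_norm_gt phi (a : R) : a < dual_norm phi ->
  exists2 x, rnorm x <= 1 & a < re (phi x).
Proof.
move=> aphi; apply: contrapT => h; move: aphi; apply/negP; rewrite -leNgt.
apply: dual_norm_re_le => x x1; rewrite leNgt; apply/negP => ax; apply: h.
by exists x.
Qed.

End duals.

Section goldstine.
Context {R : realType} {K : scalarField R} {V : normedModType K}.

(** The unit ball need not be compact, so infima are only reached up to a slack [d]. *)
Lemma near_minimizer (T : Type) (A : set T) (F : T -> R) (d : R) : A !=set0 ->
  (forall x, 0 <= F x) -> 0 < d -> exists2 x, A x & forall y, A y -> F x <= F y + d.
Proof.
move=> [x0 Ax0] F0 d0.
have hi : has_inf (F @` A).
  by split; [exists (F x0), x0|exists 0 => _ [x _ <-]].
have [_ [x Ax <-] xd] := inf_adherent d0 hi.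
exists x => // y Ay; apply: le_trans (ltW xd) _; rewrite lerD2r.
by apply: ge_inf; [case: hi|exists y].
Qed.

(* Goldstine's theorem for two functionals. Near a minimiser x over the unit ball of
   the squared distance between (re phi1, re phi2) and its prescribed value, the
   derivative of this distance is a functional that nearly attains its norm at x. *)
Lemma goldstine2 (Phi : dual_space (dual_space V)) (phi1 phi2 : dual_space V) (e : R) :
  dual_norm Phi <= 1 -> 0 < e ->
  exists x : V, [/\ rnorm x <= 1, `|re (phi1 x) - re (Phi phi1)| <= e
                  & `|re (phi2 x) - re (Phi phi2)| <= e].
Proof.
move=> Phi1 e0.
set a1 := re (Phi phi1); set a2 := re (Phi phi2).
pose F x := (re (phi1 x) - a1) ^+ 2 + (re (phi2 x) - a2) ^+ 2.
(* Between two points of the unit ball, [phi1] and [phi2] change by at most twice their norms. *)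
pose D := 4 * (dual_norm phi1 ^+ 2 + dual_norm phi2 ^+ 2).
have D0 : 0 <= D by rewrite mulr_ge0// addr_ge0 ?sqr_ge0.
(* Length of a step from [x] towards a competitor: [s <= 1] stays in the ball, and [s * D <= e ^+ 2]
   controls the second-order term. *)
pose s := Num.min 1 (e ^+ 2 / (D + 1)).
have D1 : 0 < D + 1 by rewrite ltr_wpDl.
have s0 : 0 < s by rewrite lt_min ltr01 divr_gt0 ?exprn_gt0.
have s1 : s <= 1 by rewrite ge_min lexx.
have sD : s * D <= e ^+ 2.
  apply: (@le_trans _ _ (s * (D + 1))); first by rewrite ler_wpM2l ?(ltW s0)// lerDl.
  by rewrite -ler_pdivlMr// ge_min lexx orbT.
have [|||x /= x1 xmin] := @near_minimizer V [set x | rnorm x <= 1] F (s * e ^+ 2).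
- by exists 0; rewrite /= /rnorm normr0 re0.
- by move=> x; rewrite addr_ge0 ?sqr_ge0.
- by rewrite mulr_gt0// exprn_gt0.
pose c1 := a1 - re (phi1 x); pose c2 := a2 - re (phi2 x).
(* Up to the factor [-2], [re psi] is the derivative of [F] at [x]. *)
pose psi := ofR K c1 *: phi1 + ofR K c2 *: phi2.
have psi_le y : rnorm y <= 1 -> re (psi y) <= re (psi x) + e ^+ 2.
  move=> y1; pose z := x + ofR K s *: (y - x).
  have z1 : rnorm z <= 1.
    have -> : z = ofR K (1 - s) *: x + ofR K s *: y.
      by rewrite rmorphB rmorph1 scalerBl scale1r /z scalerBr addrA addrAC.
    apply: (le_trans (ler_rnormD _ _)); rewrite !rnormZ !rnorm_ofR ?subr_ge0 ?(ltW s0)//.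
    have : (1 - s) * rnorm x <= (1 - s) * 1 by rewrite ler_wpM2l ?subr_ge0.
    have : s * rnorm y <= s * 1 by rewrite ler_wpM2l ?(ltW s0).
    lra.
  have := xmin z z1; rewrite /F.
  have E (phi : dual_space V) : re (phi z) = re (phi x) + s * (re (phi y) - re (phi x)).
    by rewrite dualD dualZr reD re_ofRM dualB reB.
  have B (phi : dual_space V) : (re (phi y) - re (phi x)) ^+ 2 <= 4 * dual_norm phi ^+ 2.
    have -> : 4 * dual_norm phi ^+ 2 = (dual_norm phi * 2) ^+ 2 by ring.
    rewrite -(@real_normK _ (_ - _)) ?num_real// ler_sqr ?nnegrE ?mulr_ge0 ?dual_norm_ge0//.
    rewrite -reB -dualB (le_trans (normr_re_dual_le _ _))// ler_wpM2l ?dual_norm_ge0//.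
    by rewrite (le_trans (ler_rnormD _ _))// rnormN; lra.
  rewrite !E; have := B phi1; have := B phi2; rewrite /psi !re_dualZD /c1 /c2.
  set p1x := re (phi1 x); set p2x := re (phi2 x).
  set h1 := re (phi1 y) - p1x; set h2 := re (phi2 y) - p2x => B2 B1 H.
  rewrite -/a1 -/a2.
  (* Near-minimality at [z] with the squares expanded; the slack carries a factor [s] so that [s]
     cancels. *)
  have H2 : s * (2 * ((a1 - p1x) * h1 + (a2 - p2x) * h2)) <= s * (e ^+ 2 + s * (h1 ^+ 2 + h2 ^+ 2)).
    by rewrite -subr_ge0; rewrite -subr_ge0 in H; apply: le_trans H _;
       rewrite le_eqVlt; apply/orP; left; apply/eqP; ring.
  rewrite ler_pM2l// in H2.
  have H3 : s * (h1 ^+ 2 + h2 ^+ 2) <= e ^+ 2.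
    by apply: le_trans sD; rewrite ler_wpM2l ?(ltW s0)// /D mulrDr lerD.
  have {H2} H4 := le_trans H2 (lerD (lexx _) H3).
  have -> : re (phi1 y) = p1x + h1 by rewrite addrC subrK.
  have -> : re (phi2 y) = p2x + h2 by rewrite addrC subrK.
  move: H4; clear; clearbody h1 h2 p1x p2x; lra.
(* By the choice of [c1] and [c2], [re (Phi psi) - re (psi x)] is exactly [F x]. *)
have Fx : F x <= e ^+ 2.
  have : re (Phi psi) <= re (psi x) + e ^+ 2.
    apply: (@le_trans _ _ (dual_norm psi)); last exact: dual_norm_re_le.
    apply: (le_trans (re_le_rnorm _)); apply: (le_trans (ler_dual_norm _ _)).
    by rewrite [rnorm psi]re_ofR ler_piMl ?dual_norm_ge0.
  rewrite dualD !dualZr reD !re_ofRM /psi re_dualZD -/a1 -/a2 /c1 /c2 /F.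
  by move=> H; rewrite -subr_ge0; rewrite -subr_ge0 in H; apply: le_trans H _;
       rewrite le_eqVlt; apply/orP; left; apply/eqP; ring.
exists x; split=> //; rewrite -ler_sqr ?nnegrE ?(ltW e0)// real_normK ?num_real//.
  by rewrite (le_trans _ Fx)// lerDl sqr_ge0.
by rewrite (le_trans _ Fx)// lerDr sqr_ge0.
Qed.

End goldstine.

(** * From uniform convexity to reflexivity *)

Section milman_pettis.
Context {R : realType} {K : scalarField R} {V : normedModType K}.

Definition uniformly_convex := forall e : R, 0 < e -> exists2 d : R, 0 < d &
  forall x y : V, rnorm x <= 1 -> rnorm y <= 1 -> 2 - d < rnorm (x + y) ->
    rnorm (x - y) <= e.

(* Completeness, tested only on sequences with geometrically decreasing steps. *)
Definition geometrically_complete := forall u : nat -> V,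
  (forall k, rnorm (u k.+1 - u k) <= 2^-1 ^+ k) ->
  exists x, forall k, rnorm (x - u k) <= 4 * 2^-1 ^+ k.

Lemma le0_geometric (C x : R) : (forall k, x <= C * 2^-1 ^+ k) -> x <= 0.
Proof.
move=> h; have cv : (fun k => C * 2^-1 ^+ k) @ \oo --> (0 : R).
  rewrite -(mulr0 C); apply: cvgM; first exact: cvg_cst.
  by apply: cvg_expr; rewrite ger0_norm ?invf_lt1 ?ltr1n.
by rewrite -(cvg_lim (@Rhausdorff R) cv); apply: limr_ge;
  [apply/cvg_ex; exists 0|exact: nearW].
Qed.

Let slice (phi : dual_space V) (d : R) :=
  [set x : V | rnorm x <= 1 /\ 1 - d < re (phi x)].

(** Both values of [re phi] exceed [1 - d / 2], so [x + y] has norm above [2 - d] and the convexity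
    hypothesis applies. *)
Lemma slice_diam (d e : R) (phi : dual_space V) (x y : V) :
  (forall x y : V, rnorm x <= 1 -> rnorm y <= 1 -> 2 - d < rnorm (x + y) ->
    rnorm (x - y) <= e) ->
  dual_norm phi <= 1 -> slice phi (d / 2) x -> slice phi (d / 2) y -> rnorm (x - y) <= e.
Proof.
move=> h phi1 [x1 phix] [y1 phiy]; apply: h => //.
apply: (@lt_le_trans _ _ (re (phi (x + y)))); first by rewrite dualD reD; lra.
apply: le_trans (re_le_rnorm _) _; apply: le_trans (ler_dual_norm _ _) _.
by rewrite ler_piMl ?rnorm_ge0.
Qed.

Lemma milman_pettis : uniformly_convex -> geometrically_complete -> reflexive_space V.
Proof.
move=> UC complete.
(* Scaling reduces to norm one; the zero functional is represented by [0]. *)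
suff unit_case (Phi : dual_space (dual_space V)) : dual_norm Phi = 1 ->
    exists v : V, Phi = bidual_eval v.
  move=> Phi; have [Phi0|Phi0] := eqVneq (dual_norm Phi) 0.
    exists 0; apply/val_inj/funext => phi /=; rewrite dual0.
    apply: rnorm0_eq0; apply/eqP; rewrite eq_le rnorm_ge0 andbT.
    by rewrite (le_trans (ler_dual_norm _ _))// Phi0 mul0r.
  have lam0 : 0 < dual_norm Phi by rewrite lt_def Phi0 dual_norm_ge0.
  have lamK : ofR K (dual_norm Phi) * ofR K (dual_norm Phi)^-1 = 1.
    by rewrite -rmorphM mulfV// rmorph1.
  have [|v vE] := unit_case (ofR K (dual_norm Phi)^-1 *: Phi).
    have := rnormZ (ofR K (dual_norm Phi)^-1) Phi.
    rewrite [rnorm Phi]re_ofR [LHS]re_ofR => ->.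
    by rewrite rnorm_ofR ?invr_ge0 ?(ltW lam0)// mulVf.
  exists (ofR K (dual_norm Phi) *: v); apply/val_inj/funext => phi /=.
  rewrite dualZr -[phi v]/(bidual_eval v phi) -vE.
  by rewrite [(_ *: Phi) phi]/(_ *: Phi phi) scalerA lamK scale1r.
move=> Phi1.
have /choice[d dP] : forall k, exists d : R, 0 < d /\
    forall x y : V, rnorm x <= 1 -> rnorm y <= 1 -> 2 - d < rnorm (x + y) ->
    rnorm (x - y) <= 2^-1 ^+ k.
  move=> k; have [|d d0 dP] := UC (2^-1 ^+ k); last by exists d.
  by rewrite exprn_gt0.
have /choice[phi phiP] : forall k, exists phi : dual_space V,
    dual_norm phi <= 1 /\ 1 - d k / 2 < re (Phi phi).
  move=> k; have [|phi phi1 phiP] := @dual_norm_gt _ _ _ Phi (1 - d k / 2).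
    by rewrite Phi1 ltrBlDr ltrDl divr_gt0//; case: (dP k).
  by exists phi; move: phi1; rewrite [rnorm phi]re_ofR.
pose S k := slice (phi k) (d k / 2).
have SS k x y : S k x -> S k y -> rnorm (x - y) <= 2^-1 ^+ k.
  by case: (dP k) (phiP k) => ? h [? _]; exact: slice_diam.
(* Goldstine for the pair [phi k], [psi]: a tolerance of at most half the gap between
   [re (Phi (phi k))] and [1 - d k / 2] keeps the point in the slice. *)
have SP k (psi : dual_space V) (e : R) : 0 < e ->
    exists x, S k x /\ `|re (psi x) - re (Phi psi)| < e.
  move=> e0; pose e' := Num.min (e / 2) ((re (Phi (phi k)) - (1 - d k / 2)) / 2).
  have gap : 0 < re (Phi (phi k)) - (1 - d k / 2) by rewrite subr_gt0; case: (phiP k).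
  have e'0 : 0 < e' by rewrite lt_min !divr_gt0.
  have [||x [x1 xk xpsi]] := @goldstine2 _ _ _ Phi (phi k) psi e'.
  - by rewrite Phi1.
  - by [].
  have e'e : e' <= e / 2 by rewrite ge_min lexx.
  have e'g : e' <= (re (Phi (phi k)) - (1 - d k / 2)) / 2 by rewrite ge_min lexx orbT.
  exists x; split; last by rewrite (le_lt_trans xpsi)// (le_lt_trans e'e)//; lra.
  split=> //; move: xk; rewrite ler_norml => /andP[xk _]; lra.
(* Taking [psi = phi k.+1], with its own gap as tolerance, puts one point in two consecutive
   slices. *)
have /choice[u uP] : forall k, exists x, S k x /\ S k.+1 x.
  move=> k; have gap : 0 < re (Phi (phi k.+1)) - (1 - d k.+1 / 2).
    by rewrite subr_gt0; case: (phiP k.+1).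
  have [x [Skx xk]] := SP k (phi k.+1) _ gap.
  exists x; split=> //; split; first by case: Skx.
  by move: xk; rewrite ltr_norml => /andP[xk _]; lra.
(* [u k.+1] and [u k.+2] share the slice of index [k.+2], so the steps decrease geometrically. *)
have [|v vP] := complete (fun k => u k.+1).
  move=> k; apply: le_trans (SS k.+2 _ _ _ _) _.
  - by case: (uP k.+2).
  - by case: (uP k.+1).
  - by rewrite ler_wiXn2l ?invr_ge0// ?invf_le1 ?ler1n// ltnW.
exists v; apply/val_inj/funext => psi /=.
suff reE (chi : dual_space V) : re (Phi chi) = re (chi v).
  apply: scalar_re_inj => a; have := reE (a *: psi).
  by rewrite dualZr.
apply/eqP; rewrite -subr_eq0 -normr_eq0; apply/eqP/le_anti.
(* A point [y] of [S k.+1] at which [chi] nearly takes the value [Phi chi] costs [2^-1 ^+ k]. Its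
   distance to [v] is at most [2^-1 + 4] times [2^-1 ^+ k], rounded up to the factor [5]. *)
rewrite normr_ge0 andbT; apply: (@le0_geometric (1 + dual_norm chi * 5)) => k.
have e0 : 0 < (2^-1 ^+ k : R) by rewrite exprn_gt0.
have [y [Sy yP]] := SP k.+1 chi _ e0.
have vy : rnorm (y - v) <= 5 * 2^-1 ^+ k.
  have -> : y - v = (y - u k.+1) + (u k.+1 - v) by rewrite addrA subrK.
  apply: (le_trans (ler_rnormD _ _)); rewrite -(rnormB v).
  have := vP k; have := SS k.+1 y (u k.+1) Sy (uP k.+1).1.
  by rewrite exprS; lra.
have -> : re (Phi chi) - re (chi v) =
    (re (Phi chi) - re (chi y)) + re (chi (y - v)) by rewrite dualB reB addrA subrK.
apply: (le_trans (ler_normD _ _)); rewrite mulrDl mul1r; apply: lerD.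
  by rewrite distrC ltW.
apply: (le_trans (normr_re_dual_le _ _)).
by rewrite -mulrA ler_wpM2l ?dual_norm_ge0.
Qed.

End milman_pettis.
Arguments uniformly_convex {R K} V.
Arguments geometrically_complete {R K} V.

(** * The two-point inequality *)

Section two_point_inequality.
Context {R : realType}.
Implicit Types (A B a b h s u v x y : R).

(** Induction on [N]: since [|u| <= 1], the cubic term created by one more factor [1 + u] is
    absorbed into the quadratic one. *)
Lemma expr1D_le N : exists2 C : R, 0 <= C &
  forall u, `|u| <= 1 -> 0 <= 1 + u -> (1 + u) ^+ N <= 1 + N%:R * u + C * u ^+ 2.
Proof.
elim: N => [|N [C C0 IH]].
  by exists 0 => // u _ _; rewrite expr0 mul0r addr0 mul0r addr0.
exists (N%:R + C + C); first by rewrite !addr_ge0.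
move=> u u1 u0; rewrite exprS.
apply: (le_trans (ler_wpM2l u0 (IH u u1 u0))).
have u2 : u * u ^+ 2 <= u ^+ 2.
  by rewrite ler_piMl ?sqr_ge0// (le_trans _ u1)// ler_norm.
have -> : (1 + u) * (1 + N%:R * u + C * u ^+ 2) =
  1 + N.+1%:R * u + (N%:R + C) * u ^+ 2 + C * (u * u ^+ 2) by rewrite -natr1; ring.
by rewrite [(_ + _ + C) * _]mulrDl [leRHS]addrA lerD2l ler_wpM2l.
Qed.

(* Young's inequality for (1 + h)(1 + k h) with the conjugate exponents s and N + 2;
   the tangent terms cancel and, for small k, a positive quadratic term remains. *)
Lemma powR1D_ge N (s := N.+2%:R / N.+1%:R : R) : exists2 k : R, 0 < k <= 1 &
  forall h, -1 <= h <= 1 -> 1 + s * h + k * h ^+ 2 <= (1 + h) `^ s.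
Proof.
have [C C0 CP] := expr1D_le N.+2.
(* Young leaves a quadratic coefficient of at least [s * k - (s - 1) * C * k ^+ 2], and [k * C <= 1]
   makes this at least [k]. *)
exists (C + 1)^-1.
  by rewrite invr_gt0 ltr_wpDl//= invf_le1 ?ltr_wpDl// lerDr.
set k := (C + 1)^-1; move=> h /andP[h1 h2].
have C1 : 0 < C + 1 by rewrite ltr_wpDl.
have k0 : 0 <= k by rewrite invr_ge0 ltW.
have k1 : k <= 1 by rewrite invf_le1// lerDr.
have kC : k * C <= 1 by rewrite mulrC ler_pdivrMr// mul1r lerDl.
have nh : `|h| <= 1 by rewrite ler_norml h1.
have nkh : `|k * h| <= 1 by rewrite normrM ger0_norm// mulr_ile1.
have kh0 : 0 <= 1 + k * h by move: nkh; rewrite ler_norml => /andP[]; lra.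
have h0 : 0 <= 1 + h by lra.
have s0 : 0 < s by rewrite divr_gt0.
have sV : s^-1 + N.+2%:R^-1 = 1.
  by rewrite /s invf_div -[X in _ + X]mul1r -mulrDl natr1 divff// pnatr_eq0.
have sN : s / N.+2%:R = s - 1.
  have -> : N.+2%:R^-1 = 1 - s^-1 by apply/eqP; rewrite eq_sym subr_eq addrC sV.
  by rewrite mulrBr mulr1 divff// gt_eqF.
have := @conjugate_powR _ (1 + h) (1 + k * h) s N.+2%:R h0 kh0 s0 (ltr0Sn _ _) sV.
rewrite powR_mulrn// => Y.
have {}Y : s * ((1 + h) * (1 + k * h)) <= (1 + h) `^ s + (s - 1) * (1 + k * h) ^+ N.+2.
  rewrite -sN; apply: (le_trans (ler_wpM2l (ltW s0) Y)).
  by rewrite mulrDr [s * (_ / s)]mulrC divfK ?gt_eqF// mulrA mulrAC lexx.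
have s1 : 0 <= s - 1 by rewrite -sN divr_ge0 ?ltW.
have E : (s - 1) * N.+2%:R = s by rewrite -sN divfK// pnatr_eq0.
have Z : (s - 1) * (1 + k * h) ^+ N.+2 <= (s - 1) + s * (k * h) + (s - 1) * (C * (k * h) ^+ 2).
  apply: (le_trans (ler_wpM2l s1 (CP _ nkh kh0))).
  by rewrite !mulrDr mulr1 [(s - 1) * (_%:R * _)]mulrA E.
have W : (s - 1) * (k * h ^+ 2) * (k * C) <= (s - 1) * (k * h ^+ 2).
  by rewrite ler_piMr// mulr_ge0// mulr_ge0// sqr_ge0.
rewrite -subr_ge0 in Y; rewrite -subr_ge0 in Z; rewrite -subr_ge0 in W.
rewrite -subr_ge0.
apply: le_trans (addr_ge0 (addr_ge0 Y Z) W) _.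
by rewrite le_eqVlt; apply/orP; left; apply/eqP; ring.
Qed.

(** Write [A] and [B] as [m * (1 + h)] and [m * (1 - h)], with [m] their mean. Adding [powR1D_ge] at
    [h] and [- h] cancels the linear terms; the resulting mean [Y] is at least 1, so [s <= 2] bounds
    it by the square of its [s]-th root. *)
Lemma power_mean_ge N (s := N.+2%:R / N.+1%:R : R) : exists2 k : R, 0 < k <= 1 &
  forall A B, 0 <= A -> 0 <= B ->
  ((A + B) / 2) ^+ 2 + k * ((A - B) / 2) ^+ 2 <= (((A `^ s + B `^ s) / 2) `^ s^-1) ^+ 2.
Proof.
have [k /andP[k0 k1] kP] := powR1D_ge N; exists k; first by rewrite k0.
move=> A B A0 B0.
have s0 : 0 < s by rewrite divr_gt0.
have s2 : s <= 2 by rewrite ler_pdivrMr// -natrM ler_nat; lia.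
have : 0 <= (A + B) / 2 by rewrite divr_ge0 ?addr_ge0.
rewrite le_eqVlt => /predU1P[m0|m0].
  have [A0' B0'] : A = 0 /\ B = 0 by split; lra.
  by rewrite A0' B0' subr0 addr0 !mul0r !expr0n mulr0 addr0 sqr_ge0.
set m := (A + B) / 2 in m0 *; pose h := (A - B) / 2 / m.
have hm : (A - B) / 2 = m * h by rewrite /h [m * _]mulrC divfK ?gt_eqF.
have AE : A = m * (1 + h) by rewrite mulrDr -hm mulr1 /m; field.
have BE : B = m * (1 - h) by rewrite mulrBr -hm mulr1 /m; field.
have h1 : 0 <= 1 + h by rewrite -(pmulr_rge0 _ m0) -AE.
have h2 : 0 <= 1 - h by rewrite -(pmulr_rge0 _ m0) -BE.
clearbody h m.
have [H1 H2] : 1 + s * h + k * h ^+ 2 <= (1 + h) `^ s /\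
               1 + s * (- h) + k * (- h) ^+ 2 <= (1 - h) `^ s.
  by split; apply: kP; apply/andP; split; lra.
rewrite hm exprMn mulrCA -[m ^+ 2 in X in X + _]mulr1 -mulrDr AE BE.
rewrite (powRM _ (ltW m0) h1) (powRM _ (ltW m0) h2) -mulrDr -mulrA powRM ?powR_ge0 ?divr_ge0 ?addr_ge0 ?powR_ge0//.
rewrite -powRrM divff ?gt_eqF// powRr1 ?(ltW m0)// exprMn ler_wpM2l ?sqr_ge0//.
set Y := (_ + _) / 2; have Yge : 1 + k * h ^+ 2 <= Y.
  by rewrite /Y sqrrN in H2 *; lra.
have Y1 : 1 <= Y by rewrite (le_trans _ Yge)// lerDl mulr_ge0 ?sqr_ge0 ?(ltW k0).
apply: (le_trans Yge); have Y0 : 0 <= Y by rewrite (le_trans _ Y1).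
have sV1 : 1 <= Y `^ s^-1 by rewrite -[leLHS](powRr0 Y) ler_powR// invr_ge0 ltW.
rewrite [leLHS](_ : Y = (Y `^ s^-1) `^ s); last by rewrite -powRrM mulVf ?gt_eqF// powRr1.
by rewrite -powR_mulrn ?powR_ge0// ler_powR.
Qed.

(** Split off one factor from each power; the remaining power [e - 1] is nondecreasing. *)
Lemma powR_superadd e x y : 1 <= e -> 0 <= x -> 0 <= y -> x `^ e + y `^ e <= (x + y) `^ e.
Proof.
move=> e1 x0 y0; have e0 : 0 < e by rewrite (lt_le_trans _ e1).
rewrite -(mulr_powRB1 x0 e0) -(mulr_powRB1 y0 e0) -(mulr_powRB1 (addr_ge0 x0 y0) e0) mulrDl.
by apply: lerD; apply: ler_wpM2l => //; apply: ge0_ler_powR;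
  rewrite ?subr_ge0 ?nnegrE ?addr_ge0// ?lerDl ?lerDr.
Qed.

Context {K : scalarField R}.

(* The parallelogram law reduces to the moduli of the two scalars. *)
Lemma two_point_ineq N q (s := N.+2%:R / N.+1%:R : R) : 2 <= q ->
  exists2 c : R, 0 < c & forall x y : K,
  (2^-1 * rnorm (x + y)) `^ q + (c * rnorm (x - y)) `^ q <=
  ((rnorm x `^ s + rnorm y `^ s) / 2) `^ s^-1 `^ q.
Proof.
move=> q2; have [k /andP[k0 k1] kP] := power_mean_ge N.
have c0 : 0 < Num.sqrt k / 2 by rewrite divr_gt0 ?sqrtr_gt0.
(* With this constant the square of the second term is [k * (rnorm (x - y) / 2) ^+ 2], the shape of
   [power_mean_ge]. *)
exists (Num.sqrt k / 2) => // x y.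
have sqr_half z : 0 <= z -> z `^ q = (z ^+ 2) `^ (q / 2).
  by move=> z0; rewrite -powR_mulrn// -powRrM mulrCA divff ?mulr1.
rewrite !sqr_half ?mulr_ge0 ?invr_ge0 ?rnorm_ge0 ?powR_ge0 ?(ltW c0)//.
have q21 : 1 <= q / 2 by rewrite ler_pdivlMr// mul1r.
apply: le_trans (powR_superadd q21 (sqr_ge0 _) (sqr_ge0 _)) _.
apply: ge0_ler_powR; rewrite ?nnegrE ?addr_ge0 ?sqr_ge0//; first by rewrite (le_trans _ q21).
apply: le_trans (kP _ _ (rnorm_ge0 x) (rnorm_ge0 y)).
have P := rnorm_parallelogram x y.
have D : (rnorm x - rnorm y) ^+ 2 <= rnorm (x - y) ^+ 2.
  rewrite -ler_sqrt ?sqr_ge0// !sqrtr_sqr [`|rnorm (_ - _)|]ger0_norm ?rnorm_ge0//.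
  rewrite ler_norml; apply/andP; split.
    by have := ler_rnormD (y - x) x; rewrite subrK rnormB; lra.
  by have := ler_rnormD (x - y) y; rewrite subrK; lra.
rewrite !exprMn sqr_sqrtr ?(ltW k0)//.
(* With [a], [b], [d] the moduli of [x], [y], [x - y], the parallelogram law turns the left side
   into [(a ^+ 2 + b ^+ 2) / 2 - (1 - k) * d ^+ 2 / 4]; as [k <= 1], replacing [d] by [|a - b|] can
   only increase it. *)
have {}D : (1 - k) * (rnorm x - rnorm y) ^+ 2 <= (1 - k) * rnorm (x - y) ^+ 2.
  by rewrite ler_wpM2l// subr_ge0.
move: P D; move: (rnorm (x + y)) (rnorm (x - y)) (rnorm x) (rnorm y) => p d a b P D.
have -> : p ^+ 2 = 2 * (a ^+ 2 + b ^+ 2) - d ^+ 2 by rewrite -P addrK.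
rewrite -subr_ge0 in D; rewrite -subr_ge0.
have {}D : 0 <= 4^-1 * ((1 - k) * d ^+ 2 - (1 - k) * (a - b) ^+ 2) by rewrite mulr_ge0.
apply: le_trans D _; rewrite le_eqVlt; apply/orP; left; apply/eqP; by field.
Qed.

End two_point_inequality.
(** * Convexity and concavity of iterated norms *)

Section power_sums.
Context {R : realType}.
Local Open Scope ereal_scope.
Implicit Types (x y : \bar R) (a r s t : R).

Lemma le_poweR a x y : (0 <= a)%R -> 0 <= x -> x <= y -> x `^ a <= y `^ a.
Proof.
move=> a0 x0 xy; apply: gt0_ler_poweR => //; rewrite in_itv/= leey andbT//.
exact: le_trans xy.
Qed.

Lemma poweRK a x : (a != 0)%R -> 0 <= x -> (x `^ a) `^ a^-1 = x.
Proof. by move=> a0 x0; rewrite -poweRrM divff// poweRe1. Qed.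

Lemma poweRVK a x : (a != 0)%R -> 0 <= x -> (x `^ a^-1) `^ a = x.
Proof. by move=> a0 x0; rewrite -poweRrM mulVf// poweRe1. Qed.

Lemma poweR_le_invr a x y : (0 < a)%R -> 0 <= x -> 0 <= y ->
  (x `^ a <= y) = (x <= y `^ a^-1).
Proof.
move=> a0 x0 y0; apply/idP/idP => h.
  by rewrite -(poweRK (lt0r_neq0 a0) x0) le_poweR ?poweR_ge0// invr_ge0 ltW.
by rewrite -(poweRVK (lt0r_neq0 a0) y0) le_poweR// ltW.
Qed.

(** On nonnegative values the powers [a] and [a^-1] are mutually inverse increasing maps, so suprema
    are preserved. *)
Lemma poweR_sup a (S : (\bar R)^nat) : (0 < a)%R -> (forall n, 0 <= S n) ->
  ereal_sup (range S) `^ a = ereal_sup (range (fun n => S n `^ a)).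
Proof.
move=> a0 S0; have sup0 (T : (\bar R)^nat) : (forall n, 0 <= T n) -> 0 <= ereal_sup (range T).
  by move=> T0; apply: le_trans (T0 0%N) _; apply: ereal_sup_ubound; exists 0%N.
have p0 n : 0 <= S n `^ a by exact: poweR_ge0.
apply/eqP; rewrite eq_le; apply/andP; split.
  rewrite poweR_le_invr ?sup0//; apply: ge_ereal_sup => _ [n _ <-].
  by rewrite -poweR_le_invr ?sup0//; apply: ereal_sup_ubound; exists n.
apply: ge_ereal_sup => _ [n _ <-]; apply: le_poweR => //; first exact: ltW.
by apply: ereal_sup_ubound; exists n.
Qed.

Definition lsum s x y := (x `^ s + y `^ s) `^ s^-1.

Lemma lsum_ge0 s x y : 0 <= lsum s x y.
Proof. exact: poweR_ge0. Qed.

Lemma lsumEFin s a b : lsum s a%:E b%:E = ((a `^ s + b `^ s) `^ s^-1)%:E.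
Proof. by rewrite /lsum !poweR_EFin. Qed.

Lemma lsum1 x y : 0 <= x -> 0 <= y -> lsum 1 x y = x + y.
Proof. by move=> x0 y0; rewrite /lsum invr1 !poweRe1// adde_ge0. Qed.

Lemma lsum00 s : (0 < s)%R -> lsum s 0 0 = 0.
Proof. by move=> s0; rewrite /lsum poweR0r ?adde0 ?poweR0r// gt_eqF// invr_gt0. Qed.

Lemma le_lsum s x y x' y' : (0 < s)%R -> 0 <= x -> 0 <= y -> x <= x' -> y <= y' ->
  lsum s x y <= lsum s x' y'.
Proof.
move=> s0 x0 y0 xx' yy'; apply: le_poweR.
- by rewrite invr_ge0 ltW.
- by rewrite adde_ge0 ?poweR_ge0.
- by apply: leeD; apply: le_poweR => //; exact: ltW.
Qed.

(* The concave counterpart of [poweR_conv], obtained from it for the exponent 1/r. *)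
Lemma poweR_conc r s t x y : (0 < r)%R -> (r <= 1)%R -> (0 < s)%R -> (0 < t)%R ->
  0 <= x -> 0 <= y ->
  ((s + t) `^ r * (s / (s + t)) / s `^ r)%:E * x `^ r +
  ((s + t) `^ r * (t / (s + t)) / t `^ r)%:E * y `^ r <= (x + y) `^ r.
Proof.
move=> r0 r1 s0 t0 x0 y0.
have st0 : (0 < s + t)%R by rewrite addr_gt0.
have c0 (u v : R) : (0 < u)%R -> (0 < v)%R -> (0 <= (u + v) `^ r * (u / (u + v)) / u `^ r)%R.
  by move=> u0 v0; rewrite !(divr_ge0, mulr_ge0) ?powR_ge0 ?addr_ge0 ?(ltW u0) ?(ltW v0).
(* [poweR_conv] with exponent [r^-1] and weights [s / (s + t)], [t / (s + t)], applied to the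
   summands of the goal, yields coefficients that cancel and leave [x + y]. *)
have e1 (u v : R) z : (0 < u)%R -> (0 < v)%R -> 0 <= z ->
    (((u / (u + v) + v / (u + v)) `^ r^-1 *
      ((u / (u + v)) / (u / (u + v) + v / (u + v))) / (u / (u + v)) `^ r^-1))%:E *
    (((u + v) `^ r * (u / (u + v)) / u `^ r)%:E * z `^ r) `^ r^-1 = z.
  move=> u0 v0 z0; have uv0 : (0 < u + v)%R by rewrite addr_gt0.
  have q0 : (0 < u / (u + v))%R by rewrite divr_gt0.
  have -> : (u / (u + v) + v / (u + v) = 1)%R by rewrite -mulrDl divff// gt_eqF.
  rewrite powR1 mul1r divr1; set q := (u / (u + v))%R in q0 *.
  have qE : q = (u / (u + v))%R by []; clearbody q.
  rewrite poweRM ?lee_fin ?mulr_ge0 ?invr_ge0 ?powR_ge0 ?poweR_ge0 ?(ltW q0)// poweRK ?gt_eqF//.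
  rewrite poweR_EFin muleA -EFinM.
  suff -> : (q / q `^ r^-1 * ((u + v) `^ r * q / u `^ r) `^ r^-1 = 1)%R by rewrite mul1e.
  rewrite !powRM ?mulr_ge0 ?invr_ge0 ?powR_ge0 ?(ltW q0)//.
  rewrite -(powR_inv1 (powR_ge0 u r)) -!powRrM mulrAC mulN1r mulrN divff ?gt_eqF//.
  rewrite powRr1 ?(ltW uv0)// powR_inv1 ?(ltW u0)//.
  have qr0 := powR_gt0 r^-1 q0.
  by rewrite {1}qE; field; rewrite !gt_eqF.
rewrite -[leLHS](@poweRVK r); last 2 first.
- by rewrite gt_eqF.
- by rewrite adde_ge0// mule_ge0 ?lee_fin ?poweR_ge0 ?c0// addrC c0.
apply: le_poweR; [exact: ltW|exact: poweR_ge0|].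
apply: le_trans (@poweR_conv _ _ (s / (s + t)) (t / (s + t)) _ _ _ _ _ _ _) _.
- by rewrite invf_ge1.
- by rewrite divr_gt0.
- by rewrite divr_gt0.
- by rewrite mule_ge0 ?lee_fin ?poweR_ge0 ?c0.
- by rewrite mule_ge0 ?lee_fin ?poweR_ge0// addrC c0.
rewrite e1//; have := @e1 t s y t0 s0 y0.
by rewrite (addrC t) (addrC (t / _)%R) => ->.
Qed.

End power_sums.

(** * Positive functionals and their power norms *)

Section positive_functionals.
Context {R : realType} {X : Type}.
Local Open Scope ereal_scope.
Implicit Types (f g : X -> \bar R).

(** Common interface of the Lebesgue integral and of weighted sums over cubes. [P] is the class of
    admissible functions, such as the measurable ones; [pf_sup] is the nontrivial half of monotone
    convergence. *)
Record positive_functional (I : (X -> \bar R) -> \bar R) (P : (X -> \bar R) -> Prop)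
    : Prop := {
  pf_le : forall f g, P f -> P g -> (forall x, 0 <= f x) -> (forall x, f x <= g x) ->
    I f <= I g;
  pf_ge0 : forall f, (forall x, 0 <= f x) -> 0 <= I f;
  pf_lin : forall k l f g, (0 <= k)%R -> (0 <= l)%R -> P f -> P g ->
    (forall x, 0 <= f x) -> (forall x, 0 <= g x) ->
    I (fun x => k%:E * f x + l%:E * g x) = k%:E * I f + l%:E * I g;
  pf_domlin : forall k l f g, P f -> P g -> P (fun x => k%:E * f x + l%:E * g x);
  pf_dompow : forall a f, P f -> P (fun x => f x `^ a);
  pf_sup : forall S : (X -> \bar R)^nat, (forall n, P (S n)) ->
    (forall n x, 0 <= S n x) -> (forall x, nondecreasing_seq (S ^~ x)) ->
    I (fun x => ereal_sup (range (S ^~ x))) <= ereal_sup (range (I \o S)) }.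

Context {I : (X -> \bar R) -> \bar R} {P : (X -> \bar R) -> Prop}.
Hypothesis pfI : positive_functional I P.

Lemma pf_domD f g : P f -> P g -> P (fun x => f x + g x).
Proof.
move=> Pf Pg; rewrite (_ : (fun x => _) = (fun x => 1%:E * f x + 1%:E * g x)).
  exact: (pf_domlin pfI).
by apply/funext => x; rewrite !mul1e.
Qed.

(** Apply [I] to [poweR_conc], whose weights [s] and [t] are taken to be the two norms [a] and [b]
    on the left; the coefficients then add up to the [r]-th power of [a + b]. *)
Lemma reverse_minkowski (r : R) f g : (0 < r)%R -> (r <= 1)%R ->
  (forall x, 0 <= f x) -> (forall x, 0 <= g x) -> P f -> P g ->
  I (fun x => f x `^ r) `^ r^-1 + I (fun x => g x `^ r) `^ r^-1 <=
    I (fun x => (f x + g x) `^ r) `^ r^-1.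
Proof.
move=> r0 r1 f0 g0 Pf Pg.
have fr0 x : 0 <= f x `^ r by exact: poweR_ge0.
have gr0 x : 0 <= g x `^ r by exact: poweR_ge0.
have Pfr := pf_dompow pfI r Pf; have Pgr := pf_dompow pfI r Pg.
have Pfgr := pf_dompow pfI r (pf_domD Pf Pg).
have rV0 : (0 <= r^-1)%R by rewrite invr_ge0 ltW.
have A0 := pf_ge0 pfI fr0; have B0 := pf_ge0 pfI gr0.
have leA : I (fun x => f x `^ r) `^ r^-1 <= I (fun x => (f x + g x) `^ r) `^ r^-1.
  apply: le_poweR => //; apply: (pf_le pfI) => // x; apply: le_poweR => //; first exact: ltW.
  by rewrite leeDl.
have leB : I (fun x => g x `^ r) `^ r^-1 <= I (fun x => (f x + g x) `^ r) `^ r^-1.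
  apply: le_poweR => //; apply: (pf_le pfI) => // x; apply: le_poweR => //; first exact: ltW.
  by rewrite leeDr.
(* [poweR_conc] needs both norms positive and finite; the other cases follow by monotonicity. *)
have [a0|a0] := eqVneq (I (fun x => f x `^ r) `^ r^-1) 0; first by rewrite a0 add0e.
have [b0|b0] := eqVneq (I (fun x => g x `^ r) `^ r^-1) 0; first by rewrite b0 adde0.
have [aoo|aoo] := eqVneq (I (fun x => f x `^ r) `^ r^-1) +oo.
  by move: leA; rewrite aoo leye_eq => /eqP ->; rewrite leey.
have [boo|boo] := eqVneq (I (fun x => g x `^ r) `^ r^-1) +oo.
  by move: leB; rewrite boo leye_eq => /eqP ->; rewrite leey.
move: a0 b0 aoo boo {leA leB}.
have AE := poweRVK (lt0r_neq0 r0) A0; have BE := poweRVK (lt0r_neq0 r0) B0.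
have := poweR_ge0 (I (fun x => f x `^ r)) r^-1; have := poweR_ge0 (I (fun x => g x `^ r)) r^-1.
move: (I (fun x => f x `^ r) `^ r^-1) (I (fun x => g x `^ r) `^ r^-1) AE BE.
move=> [a||] [b||]// AE BE.
rewrite !lee_fin !eqe => b0 a0 an0 bn0 _ _.
have {}a0 : (0 < a)%R by rewrite lt_def an0.
have {}b0 : (0 < b)%R by rewrite lt_def bn0.
have ab0 : (0 < a + b)%R by rewrite addr_gt0.
rewrite -EFinD -poweR_le_invr ?lee_fin ?(ltW ab0)//; last first.
  by apply: (pf_ge0 pfI) => x; exact: poweR_ge0.
have c0 (u v : R) : (0 < u)%R -> (0 < v)%R -> (0 <= (u + v) `^ r * (u / (u + v)) / u `^ r)%R.
  by move=> u0 v0; rewrite !(divr_ge0, mulr_ge0) ?powR_ge0 ?addr_ge0 ?(ltW u0) ?(ltW v0).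
have c0' := c0 _ _ b0 a0; rewrite (addrC b) in c0'.
apply: le_trans (pf_le pfI (pf_domlin pfI ((a + b) `^ r * (a / (a + b)) / a `^ r)
  ((a + b) `^ r * (b / (a + b)) / b `^ r) Pfr Pgr) Pfgr _ _); last 2 first.
- by move=> x; rewrite adde_ge0// mule_ge0// lee_fin ?c0.
- by move=> x; apply: poweR_conc.
rewrite (pf_lin pfI)//; last exact: c0.
rewrite -AE -BE !poweR_EFin -!EFinM -EFinD lee_fin !divfK ?gt_eqF ?powR_gt0//.
by rewrite -mulrDr -mulrDl divff ?gt_eqF// mulr1.
Qed.

Definition pfnorm (p : R) f := I (fun x => f x `^ p) `^ p^-1.

Lemma pfnorm_ge0 p f : 0 <= pfnorm p f.
Proof. exact: poweR_ge0. Qed.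

Lemma le_pfnorm p f g : (0 < p)%R -> P f -> P g -> (forall x, 0 <= f x) ->
  (forall x, f x <= g x) -> pfnorm p f <= pfnorm p g.
Proof.
move=> p0 Pf Pg f0 fg; apply: le_poweR.
- by rewrite invr_ge0 ltW.
- by apply: (pf_ge0 pfI) => x; exact: poweR_ge0.
- apply: (pf_le pfI) => [||x|x]; [exact: (pf_dompow pfI)..|exact: poweR_ge0|].
  by apply: le_poweR => //; exact: ltW.
Qed.

Lemma pf_dom_lsum s f g : P f -> P g -> P (fun x => lsum s (f x) (g x)).
Proof.
move=> Pf Pg; apply: (pf_dompow pfI s^-1 (pf_domD _ _)); exact: (pf_dompow pfI).
Qed.

(** Passing from [f] to its [s]-th power trades the exponent [p] for [p / s], where Minkowski or its
    reverse applies. *)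
Let pfnorm_poweR p s f : (0 < s)%R -> (0 < p)%R ->
  pfnorm p f `^ s = I (fun x => (f x `^ s) `^ (p / s)) `^ (p / s)^-1.
Proof.
move=> s0 p0; rewrite /pfnorm -poweRrM invf_div mulrC; congr (I _ `^ _).
by apply/funext => x; rewrite -poweRrM mulrCA divff ?mulr1// gt_eqF.
Qed.

Let lsum_pow s p f g : (0 < s)%R -> (fun x => lsum s (f x) (g x) `^ p) =
  (fun x => (f x `^ s + g x `^ s) `^ (p / s)).
Proof. by move=> s0; apply/funext => x; rewrite /lsum -poweRrM mulrC. Qed.

Lemma pfnorm_lsum_le p s f g : (0 < s)%R -> (s <= p)%R ->
  P f -> P g -> (forall x, 0 <= f x) -> (forall x, 0 <= g x) ->
  pfnorm p (fun x => lsum s (f x) (g x)) <= lsum s (pfnorm p f) (pfnorm p g).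
Proof.
move=> s0 sp Pf Pg f0 g0; have p0 : (0 < p)%R by rewrite (lt_le_trans s0).
rewrite {2}/lsum !pfnorm_poweR// {1}/pfnorm lsum_pow//.
have -> : p^-1%R = ((p / s)^-1 * s^-1)%R by rewrite invf_div mulrAC divff ?mul1r// gt_eqF.
rewrite poweRrM; apply: le_poweR; [by rewrite invr_ge0 ltW|exact: poweR_ge0|].
apply: (@abstract_minkowski _ _ I P).
- by rewrite ler_pdivlMr// mul1r.
- exact: (pf_le pfI).
- by move=> h _; exact: (pf_ge0 pfI).
- exact: (pf_lin pfI).
- exact: (pf_domlin pfI).
- by move=> x; exact: poweR_ge0.
- by move=> x; exact: poweR_ge0.
- by apply: (pf_dompow pfI (p / s)); exact: (pf_dompow pfI).
- by apply: (pf_dompow pfI (p / s)); exact: (pf_dompow pfI).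
- by apply: (pf_dompow pfI (p / s)); apply: pf_domD; exact: (pf_dompow pfI).
Qed.

Lemma pfnorm_lsum_ge p s f g : (0 < p)%R -> (p <= s)%R ->
  P f -> P g -> (forall x, 0 <= f x) -> (forall x, 0 <= g x) ->
  lsum s (pfnorm p f) (pfnorm p g) <= pfnorm p (fun x => lsum s (f x) (g x)).
Proof.
move=> p0 ps Pf Pg f0 g0; have s0 : (0 < s)%R by rewrite (lt_le_trans p0).
rewrite {1}/lsum !pfnorm_poweR// {1}/pfnorm lsum_pow//.
have -> : p^-1%R = ((p / s)^-1 * s^-1)%R by rewrite invf_div mulrAC divff ?mul1r// gt_eqF.
rewrite poweRrM; apply: le_poweR.
- by rewrite invr_ge0 ltW.
- by rewrite adde_ge0 ?poweR_ge0.
apply: reverse_minkowski.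
- by rewrite divr_gt0.
- by rewrite ler_pdivrMr// mul1r.
- by move=> x; exact: poweR_ge0.
- by move=> x; exact: poweR_ge0.
- exact: (pf_dompow pfI).
- exact: (pf_dompow pfI).
Qed.

(** Both powers in the norm commute with suprema, so monotone convergence passes from [I] to the
    norm. *)
Lemma pfnorm_sup p (S : (X -> \bar R)^nat) : (0 < p)%R ->
  (forall n, P (S n)) -> (forall n x, 0 <= S n x) ->
  (forall x, nondecreasing_seq (S ^~ x)) ->
  pfnorm p (fun x => ereal_sup (range (S ^~ x))) <= ereal_sup (range (pfnorm p \o S)).
Proof.
move=> p0 PS S0 ndS; rewrite /pfnorm.
rewrite [X in I X](_ : _ = (fun x => ereal_sup (range (fun n => S n x `^ p)))); last first.
  by apply/funext => x; rewrite poweR_sup.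
have Sp n : P (fun x => S n x `^ p) by exact: (pf_dompow pfI).
rewrite [leRHS](_ : _ =
    ereal_sup (range (fun n => I (fun x => S n x `^ p))) `^ p^-1); last first.
  rewrite poweR_sup ?invr_gt0// => n.
  by apply: (pf_ge0 pfI) => // x; exact: poweR_ge0.
apply: le_poweR; first by rewrite invr_ge0 ltW.
- apply: (pf_ge0 pfI) => x; apply: le_trans (poweR_ge0 (S 0%N x) p) _.
  by apply: ereal_sup_ubound; exists 0%N.
- apply: (@pf_sup _ _ pfI (fun n x => S n x `^ p)) => //.
    by move=> n x; exact: poweR_ge0.
  by move=> x m n mn; apply: le_poweR => //; [exact: ltW|exact: ndS].
Qed.

End positive_functionals.
Arguments pfnorm {R X} I p f.

Section instances.
Context {R : realType}.
Local Open Scope ereal_scope.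

Lemma measurable_ereal_sup d (T : measurableType d) (S : (T -> \bar R)^nat) :
  (forall n, measurable_fun setT (S n)) ->
  measurable_fun setT (fun x => ereal_sup (range (S ^~ x))).
Proof.
move=> mS; rewrite (_ : (fun x => _) = (fun x => esups (S ^~ x) 0%N)).
  exact: measurable_fun_esups.
by apply/funext => x; congr ereal_sup; apply/seteqP; split => _ [n _ <-]; exists n.
Qed.

Lemma positive_functional_integral d (T : measurableType d)
    (mu : {measure set T -> \bar R}) :
  positive_functional (fun f => \int[mu]_x f x) (measurable_fun setT).
Proof.
split.
- by move=> f g mf mg f0 fg; exact: ge0_le_integral.
- by move=> f f0; exact: integral_ge0.
- move=> k l f g k0 l0 mf mg f0 g0; rewrite ge0_integralD//.
  + by rewrite !ge0_integralZl_EFin.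
  + by move=> x _; rewrite mule_ge0.
  + exact: measurable_funeM.
  + by move=> x _; rewrite mule_ge0.
  + exact: measurable_funeM.
- by move=> k l f g mf mg; apply: emeasurable_funD; exact: measurable_funeM.
- by move=> a f mf; exact: (measurableT_comp (measurable_poweR a)).
- move=> S mS S0 ndS.
  rewrite (_ : (fun x => _) = (fun x => limn (S ^~ x))); last first.
    apply/funext => x; apply/esym/cvg_lim => //.
    by apply: ereal_nondecreasing_cvgn; exact: ndS.
  rewrite (monotone_convergence _ _ mS)//.
  rewrite le_eqVlt; apply/orP; left; apply/eqP/cvg_lim => //.
  apply: ereal_nondecreasing_cvgn => m n mn; apply: ge0_le_integral => //.
  by move=> x _; exact: ndS.
Qed.

Lemma fsume_sup (T : choiceType) (A : set T) (S : nat -> T -> \bar R) : finite_set A ->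
  (forall n x, 0 <= S n x) -> (forall x, nondecreasing_seq (S ^~ x)) ->
  \sum_(x \in A) ereal_sup (range (S ^~ x)) <=
  ereal_sup (range (fun n => \sum_(x \in A) S n x)).
Proof.
move=> finA S0 ndS; rewrite fsbig_finite//=.
rewrite (eq_bigr (fun x => limn (S ^~ x))); last first.
  by move=> x _; apply/esym/cvg_lim => //; apply: ereal_nondecreasing_cvgn; exact: ndS.
rewrite -(lim_nnesum _ (fun=> 0)); last 2 first.
- by move=> x _; exact: nearW.
- by move=> x _; exact: ereal_nondecreasing_is_cvgn (ndS x).
rewrite le_eqVlt; apply/orP; left; apply/eqP/cvg_lim => //.
have E n : \sum_(x \in A) S n x = \sum_(x <- finmap.enum_fset (fset_set A)) S n x.
  by rewrite fsbig_finite.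
rewrite (funext E); apply: ereal_nondecreasing_cvgn => m n mn.
by apply: lee_sum => x _; exact: ndS.
Qed.

Lemma positive_functional_esum (T : choiceType) (c : T -> R) : (forall q, (0 <= c q)%R) ->
  positive_functional (fun f => \esum_(q in [set: T]) ((c q)%:E * f q)) (fun=> True).
Proof.
move=> c0; have cf0 f q : (forall q, 0 <= f q) -> 0 <= (c q)%:E * f q.
  by move=> f0; rewrite mule_ge0 ?lee_fin.
split=> //.
- move=> f g _ _ f0 fg; apply: le_esum => q _; apply: lee_wpmul2l; rewrite ?lee_fin//.
- by move=> f f0; apply: esum_ge0 => q _; exact: cf0.
- move=> k l f g k0 l0 _ _ f0 g0.
  rewrite -!esumZ//; [|by move=> q; exact: cf0..].
  rewrite -esumD; [|by move=> q _; rewrite mule_ge0 ?lee_fin ?cf0..].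
  apply: eq_esum => q _.
  by rewrite ge0_muleDr ?mule_ge0 ?lee_fin// !muleA ![((c q)%:E * _)%E]muleC.
- move=> S _ S0 ndS; apply: ge_ereal_sup => _ [A [finA _] <-].
  have nd q : nondecreasing_seq (fun n => (c q)%:E * S n q).
    by move=> m n mn; apply: lee_wpmul2l; rewrite ?lee_fin//; exact: ndS.
  rewrite (eq_fsbigr (fun q => ereal_sup (range (fun n => (c q)%:E * S n q)))); last first.
    (* A zero weight is treated apart: a weight is pulled out of a supremum only when positive. *)
    move=> q _; have [->|cq] := eqVneq (c q) 0%R.
      rewrite mul0e; apply/esym/eqP; rewrite eq_le; apply/andP; split.
        by apply: ge_ereal_sup => _ [n _ <-]; rewrite mul0e.
      by apply: ereal_sup_ubound; exists 0%N; rewrite ?mul0e.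
    rewrite -ereal_sup_pZl; last by rewrite lt_def cq c0.
    by congr ereal_sup; apply/seteqP; split => [_ [_ [n _ <-] <-]|_ [n _ <-]];
      [exists n|exists (S n q) => //; exists n].
  apply: le_trans (fsume_sup finA _ nd) _; first by move=> n q; exact: cf0.
  apply: ge_ereal_sup => _ [n _ <-].
  apply: (@le_trans _ _ (\esum_(q in [set: T]) ((c q)%:E * S n q))).
    by apply: ereal_sup_ubound; exists A.
  by apply: ereal_sup_ubound; exists n.
Qed.

End instances.

Section mixed_norms.
Context {R : realType}.
Local Open Scope ereal_scope.
Local Notation mu := (@lebesgue_measure R).
Local Notation intmu := (fun f : R -> \bar R => \int[mu]_x f x).

Lemma LnormE p (f : R -> \bar R) : (forall x, 0 <= f x) ->
  'N[mu]_p%:E[f] = pfnorm intmu p f.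
Proof.
by move=> f0; rewrite unlock /pfnorm; congr (_ `^ _); apply: eq_integral => x _; rewrite gee0_abs.
Qed.

Lemma measurable_section n (f : n.+1.-tuple R -> \bar R) (y : n.-tuple R) :
  measurable_fun setT f -> measurable_fun setT (fun x => f [tuple of x :: y]).
Proof. by move=> mf; apply: (measurableT_comp mf); exact: measurable_cons. Qed.

Lemma measurable_Lnorm_section n p (f : n.+1.-tuple R -> \bar R) :
  measurable_fun setT f ->
  measurable_fun setT (fun y : n.-tuple R => 'N[mu]_p%:E[(fun x => f [tuple of x :: y])]).
Proof.
move=> mf; rewrite unlock; apply: (measurableT_comp (measurable_poweR _)).
pose F := fun z : R * n.-tuple R => `|f [tuple of z.1 :: z.2]| `^ p.
apply: (@measurable_fun_fubini_tonelli_G _ _ _ _ _ mu F).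
  apply: (measurableT_comp (measurable_poweR _)); apply: measurableT_comp => //.
  by apply: (measurableT_comp mf); exact: measurable_cons.
by move=> z; exact: poweR_ge0.
Qed.

(** The Dirac mass only serves to instantiate the interface, whose closure properties are about
    measurability. *)
Lemma measurable_lsum d (T : measurableType d) s (f g : T -> \bar R) :
  measurable_fun setT f -> measurable_fun setT g ->
  measurable_fun setT (fun x => lsum s (f x) (g x)).
Proof. exact: (pf_dom_lsum (positive_functional_integral (@dirac _ T point R))). Qed.

Let pfmu := positive_functional_integral mu.

(** Induction on the number of variables: the one-dimensional inequality in the innermost variable,
    monotonicity of the outer norm, then the induction hypothesis. The reverse inequality and the
    passage to suprema follow the same scheme. *)
Lemma mixed_norm_lsum_le n (p : n.-tuple R) s F G : (0 < s)%R ->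
  (forall i, s <= tnth p i)%R -> measurable_fun setT F -> measurable_fun setT G ->
  (forall x, 0 <= F x) -> (forall x, 0 <= G x) ->
  mixed_norm p (fun x => lsum s (F x) (G x)) <= lsum s (mixed_norm p F) (mixed_norm p G).
Proof.
move=> s0; elim: n p F G => [|n IH] p F G sp mF mG F0 G0 /=.
  by rewrite !gee0_abs// lsum_ge0.
apply: le_trans _ (IH [tuple of behead p] (fun y => 'N[mu]_(thead p)%:E[(fun x => F [tuple of x :: y])])
  (fun y => 'N[mu]_(thead p)%:E[(fun x => G [tuple of x :: y])]) _ _ _ _ _).
- apply: le_mixed_norm.
  + by move=> i; rewrite tnth_behead (le_trans (ltW s0)).
  + apply: (@measurable_Lnorm_section _ (thead p) (fun x => lsum s (F x) (G x))).
    exact: measurable_lsum.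
  + by apply: measurable_lsum; exact: measurable_Lnorm_section.
  + by move=> y; exact: Lnorm_ge0.
  + move=> y; rewrite !LnormE//; last by move=> x; exact: lsum_ge0.
    by apply: (pfnorm_lsum_le pfmu) => //; [exact: sp|exact: measurable_section..].
- by move=> i; rewrite tnth_behead.
- exact: measurable_Lnorm_section.
- exact: measurable_Lnorm_section.
- by move=> y; exact: Lnorm_ge0.
- by move=> y; exact: Lnorm_ge0.
Qed.

Lemma mixed_norm_lsum_ge n (p : n.-tuple R) s F G :
  (forall i, 0 < tnth p i)%R -> (forall i, tnth p i <= s)%R ->
  measurable_fun setT F -> measurable_fun setT G ->
  (forall x, 0 <= F x) -> (forall x, 0 <= G x) ->
  lsum s (mixed_norm p F) (mixed_norm p G) <= mixed_norm p (fun x => lsum s (F x) (G x)).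
Proof.
elim: n p F G => [|n IH] p F G p0 ps mF mG F0 G0 /=.
  by rewrite !gee0_abs// lsum_ge0.
apply: le_trans (IH [tuple of behead p] _ _ _ _ _ _ _ _) _.
- by move=> i; rewrite tnth_behead.
- by move=> i; rewrite tnth_behead.
- exact: measurable_Lnorm_section.
- exact: measurable_Lnorm_section.
- by move=> y; exact: Lnorm_ge0.
- by move=> y; exact: Lnorm_ge0.
- apply: le_mixed_norm.
  + by move=> i; rewrite tnth_behead ltW.
  + by apply: measurable_lsum; exact: measurable_Lnorm_section.
  + apply: (@measurable_Lnorm_section _ (thead p) (fun x => lsum s (F x) (G x))).
    exact: measurable_lsum.
  + by move=> y; exact: lsum_ge0.
  + move=> y; rewrite !LnormE//; last by move=> x; exact: lsum_ge0.
    by apply: (pfnorm_lsum_ge pfmu) => //; [exact: p0|exact: ps|exact: measurable_section..].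
Qed.

Lemma mixed_norm_sup n (p : n.-tuple R) (S : (n.-tuple R -> \bar R)^nat) :
  (forall i, 0 < tnth p i)%R -> (forall k, measurable_fun setT (S k)) ->
  (forall k x, 0 <= S k x) -> (forall x, nondecreasing_seq (S ^~ x)) ->
  mixed_norm p (fun x => ereal_sup (range (S ^~ x))) <= ereal_sup (range (mixed_norm p \o S)).
Proof.
elim: n p S => [|n IH] p S p0 mS S0 ndS /=.
  rewrite gee0_abs; last first.
    by apply: le_trans (S0 0%N _) _; apply: ereal_sup_ubound; exists 0%N.
  apply: ge_ereal_sup => _ [k _ <-]; apply: ereal_sup_ubound; exists k => //=.
  by rewrite gee0_abs.
have sup0 x : 0 <= ereal_sup (range (S ^~ x)).
  by apply: le_trans (S0 0%N _) _; apply: ereal_sup_ubound; exists 0%N.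
apply: le_trans _ (IH [tuple of behead p]
  (fun k y => 'N[mu]_(thead p)%:E[(fun x => S k [tuple of x :: y])]) _ _ _ _).
- apply: le_mixed_norm.
  + by move=> i; rewrite tnth_behead ltW.
  + apply: (@measurable_Lnorm_section _ (thead p) (fun x => ereal_sup (range (S ^~ x)))).
    exact: measurable_ereal_sup.
  + by apply: measurable_ereal_sup => k; exact: measurable_Lnorm_section.
  + by move=> y; exact: Lnorm_ge0.
  + move=> y; rewrite LnormE//.
    rewrite (_ : (fun k : nat => _) =
        (pfnorm intmu (thead p) \o (fun k x => S k [tuple of x :: y]))); last first.
      by apply/funext => k; rewrite LnormE.
    apply: (pfnorm_sup pfmu (S := fun k x => S k [tuple of x :: y])) => //.
      exact: p0.
    by move=> k; exact: measurable_section.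
- by move=> i; rewrite tnth_behead.
- by move=> k; exact: measurable_Lnorm_section.
- by move=> k y; exact: Lnorm_ge0.
- move=> y k l kl; apply: le_Lnorm.
  + exact/ltW/p0.
  + exact: measurable_section.
  + exact: measurable_section.
  + by move=> x.
  + by move=> x; exact: ndS.
Qed.

End mixed_norms.

Section local_norms.
Context {R : realType} {T : choiceType} {n : nat}.
Variables (c : T -> R) (Q : T -> set (n.-tuple R)) (p : n.-tuple R) (r : R).
Local Open Scope ereal_scope.
Implicit Types F G : n.-tuple R -> \bar R.

(** The cubes and their volume factors are abstracted into sets [Q q] and weights [c q]. *)
Definition local_norm F := pfnorm (fun h => \esum_(q in [set: T]) ((c q)%:E * h q)) r
  (fun q => mixed_norm p (F \_ (Q q))).

Hypothesis c0 : forall q, (0 <= c q)%R.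
Hypothesis mQ : forall q, measurable (Q q).
Hypothesis p0 : forall i, (0 < tnth p i)%R.
Hypothesis r0 : (0 < r)%R.

Let pfc := positive_functional_esum c0.

Let measurable_patch F q : measurable_fun setT F -> measurable_fun setT (F \_ (Q q)).
Proof. by move=> mF; apply: (measurable_restrictT F (mQ q)).1; exact: measurable_funTS. Qed.

Let patch_ge0 F q : (forall x, 0 <= F x) -> forall x, 0 <= (F \_ (Q q)) x.
Proof. by move=> F0 x; rewrite patchE; case: ifP. Qed.

Let patch_lsum s F G q : (0 < s)%R ->
  (fun x => lsum s (F x) (G x)) \_ (Q q) = fun x => lsum s ((F \_ (Q q)) x) ((G \_ (Q q)) x).
Proof.
by move=> s0; apply/funext => x; rewrite !patchE; case: ifP => //; rewrite lsum00.
Qed.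

Lemma le_local_norm F G : measurable_fun setT F -> measurable_fun setT G ->
  (forall x, 0 <= F x) -> (forall x, F x <= G x) -> local_norm F <= local_norm G.
Proof.
move=> mF mG F0 FG; apply: (le_pfnorm pfc) => // q; first exact: mixed_norm_ge0.
apply: le_mixed_norm.
- by move=> i; exact: ltW.
- exact: measurable_patch.
- exact: measurable_patch.
- exact: patch_ge0.
- by move=> x; rewrite !patchE; case: ifP.
Qed.

Lemma local_norm_lsum_le s F G : (0 < s)%R -> (forall i, s <= tnth p i)%R -> (s <= r)%R ->
  measurable_fun setT F -> measurable_fun setT G ->
  (forall x, 0 <= F x) -> (forall x, 0 <= G x) ->
  local_norm (fun x => lsum s (F x) (G x)) <= lsum s (local_norm F) (local_norm G).
Proof.
move=> s0 sp sr mF mG F0 G0.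
apply: le_trans _ (pfnorm_lsum_le pfc s0 sr _ _ _ _) => //; last 2 first.
- by move=> q; exact: mixed_norm_ge0.
- by move=> q; exact: mixed_norm_ge0.
apply: (le_pfnorm pfc) => // q; first exact: mixed_norm_ge0.
rewrite patch_lsum//; apply: mixed_norm_lsum_le => //.
- exact: measurable_patch.
- exact: measurable_patch.
- exact: patch_ge0.
- exact: patch_ge0.
Qed.

Lemma local_norm_lsum_ge s F G : (forall i, tnth p i <= s)%R -> (r <= s)%R ->
  measurable_fun setT F -> measurable_fun setT G ->
  (forall x, 0 <= F x) -> (forall x, 0 <= G x) ->
  lsum s (local_norm F) (local_norm G) <= local_norm (fun x => lsum s (F x) (G x)).
Proof.
move=> ps rs mF mG F0 G0; have s0 : (0 < s)%R by rewrite (lt_le_trans r0).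
apply: le_trans (pfnorm_lsum_ge pfc r0 rs _ _ _ _) _ => //.
- by move=> q; exact: mixed_norm_ge0.
- by move=> q; exact: mixed_norm_ge0.
apply: (le_pfnorm pfc) => // q; first exact: lsum_ge0.
rewrite patch_lsum//; apply: mixed_norm_lsum_ge => //.
- exact: measurable_patch.
- exact: measurable_patch.
- exact: patch_ge0.
- exact: patch_ge0.
Qed.

Lemma local_norm_sup (S : (n.-tuple R -> \bar R)^nat) :
  (forall k, measurable_fun setT (S k)) ->
  (forall k x, 0 <= S k x) -> (forall x, nondecreasing_seq (S ^~ x)) ->
  local_norm (fun x => ereal_sup (range (S ^~ x))) <= ereal_sup (range (local_norm \o S)).
Proof.
move=> mS S0 ndS.
apply: le_trans _ (pfnorm_sup pfc (S := fun k q => mixed_norm p (S k \_ (Q q))) r0 _ _ _) => //.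
- apply: (le_pfnorm pfc) => // q; first exact: mixed_norm_ge0.
  rewrite (_ : _ \_ _ = fun x => ereal_sup (range (fun k => (S k \_ (Q q)) x))).
    apply: mixed_norm_sup => //.
    + by move=> k; exact: measurable_patch.
    + by move=> k; exact: patch_ge0.
    + by move=> x k l kl; rewrite !patchE; case: ifP => // _; exact: ndS.
  apply/funext => x; rewrite patchE; case: ifPn => xQ.
    by congr ereal_sup; apply/seteqP; split=> _ [k _ <-]; exists k; rewrite ?patchE ?xQ.
  (* Off [Q q] every term is [0], and so is the supremum because the range is nonempty. *)
  rewrite (_ : (fun k => _) = cst 0) ?ereal_sup_cst//; first by apply/set0P; exists 0%N.
  by apply/funext => k; rewrite patchE (negbTE xQ).
- by move=> k q; exact: mixed_norm_ge0.
- move=> q k l kl; apply: le_mixed_norm.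
  + by move=> i; exact: ltW.
  + exact: measurable_patch.
  + exact: measurable_patch.
  + exact: patch_ge0.
  + by move=> x; rewrite !patchE; case: ifP => // _; exact: ndS.
Qed.

End local_norms.

(** * Uniform convexity *)

(* [BMnorm] depends only on the modulus; this is the same norm on extended nonnegative
   functions, so that suprema of moduli can be measured. *)
Definition BMenorm (R : realType) n (p : n.-tuple R) (t r : R) (F : n.-tuple R -> \bar R) :=
  local_norm (fun q : int * n.-tuple int => dyadic_volume (n := n) q.1 `^ BMexponent p t r)
    (fun q => dyadic_cube q.1 q.2) p r F.

Section BMenorm.
Context {R : realType} {n : nat}.
Variables (p : n.-tuple R) (t r : R).
Hypotheses (p0 : forall i, (0 < tnth p i)) (r0 : 0 < r).
Implicit Types F G : n.-tuple R -> \bar R.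
Local Open Scope ereal_scope.

Local Notation norm := (BMenorm p t r).

Let vol0 (q : int * n.-tuple int) : (0 <= dyadic_volume (n := n) q.1 `^ BMexponent p t r)%R.
Proof. exact: powR_ge0. Qed.

Let mcube (q : int * n.-tuple int) : measurable (dyadic_cube (R := R) q.1 q.2).
Proof. exact: measurable_dyadic_cube. Qed.

Lemma le_BMenorm F G : measurable_fun setT F -> measurable_fun setT G ->
  (forall x, 0 <= F x) -> (forall x, F x <= G x) -> norm F <= norm G.
Proof. exact: le_local_norm. Qed.

Lemma BMenorm_lsum_le s F G : (0 < s)%R -> (forall i, s <= tnth p i)%R -> (s <= r)%R ->
  measurable_fun setT F -> measurable_fun setT G ->
  (forall x, 0 <= F x) -> (forall x, 0 <= G x) ->
  norm (fun x => lsum s (F x) (G x)) <= lsum s (norm F) (norm G).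
Proof. exact: local_norm_lsum_le. Qed.

Lemma BMenorm_lsum_ge s F G : (forall i, tnth p i <= s)%R -> (r <= s)%R ->
  measurable_fun setT F -> measurable_fun setT G ->
  (forall x, 0 <= F x) -> (forall x, 0 <= G x) ->
  lsum s (norm F) (norm G) <= norm (fun x => lsum s (F x) (G x)).
Proof. exact: local_norm_lsum_ge. Qed.

Lemma BMenorm_sup (S : (n.-tuple R -> \bar R)^nat) :
  (forall k, measurable_fun setT (S k)) ->
  (forall k x, 0 <= S k x) -> (forall x, nondecreasing_seq (S ^~ x)) ->
  norm (fun x => ereal_sup (range (S ^~ x))) <= ereal_sup (range (norm \o S)).
Proof. exact: local_norm_sup. Qed.

End BMenorm.

Lemma BMnormE (R : realType) (K : scalarField R) n (p : n.-tuple R) (t r : R)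
    (f : n.-tuple R -> K^o) :
  BMnorm p t r f = BMenorm p t r (fun x => (rnorm (f x))%:E).
Proof.
rewrite /BMnorm /BMenorm /local_norm /pfnorm; congr (_ `^ _)%E; apply: eq_esum => q _.
congr (_ * _ `^ _)%E; rewrite /mixed_Lnorm; congr mixed_norm; apply/funext => x.
by rewrite patchE; case: ifP => _; rewrite ?mulr1n// mulr0n /rnorm normr0 re0.
Qed.

(** * A Clarkson-type inequality *)

Section mixedBM_convexity.
Context {R : realType} (K : scalarField R) {n : nat}.
Variables (p : n.-tuple R) (t r : R).
Hypotheses (p1 : forall i, 1 < tnth p i) (r1 : 1 < r).
Implicit Types f g : n.-tuple R -> K^o.

Let p0 i : 0 < tnth p i. Proof. exact: lt_trans (p1 i). Qed.
Let r0 : 0 < r. Proof. exact: lt_trans r1. Qed.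
Let p1' i : 1 <= tnth p i. Proof. exact: ltW. Qed.

Local Notation norm := (BMenorm p t r).

Local Notation BM := (BMnorm p t r).

(** There are finitely many exponents, all above 1, so [1 + N.+1%:R^-1] lies below their minimum for
    some [N]; this is the form of exponent handled by [two_point_ineq]. *)
Lemma ex_convexity_exponents : exists N (q : R), [/\ 2 <= q,
  forall i, N.+2%:R / N.+1%:R <= tnth p i <= q & N.+2%:R / N.+1%:R <= r <= q].
Proof.
pose m := \big[Num.min/r]_i tnth p i; pose q := \big[Num.max/Num.max 2 r]_i tnth p i.
have m1 : 1 < m by apply: lt_bigmin.
have [N Nm] := ltr_add_invr m1.
have sE : N.+2%:R / N.+1%:R = 1 + N.+1%:R^-1 :> R.
  by rewrite -natr1 mulrDl divff ?mul1r// pnatr_eq0.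
have qm : Num.max 2 r <= q by apply: bigmax_ge_id.
exists N, q; rewrite sE; split.
- by rewrite (le_trans _ qm)// le_max lexx.
- move=> i; apply/andP; split; last exact: le_bigmax.
  by apply: le_trans (ltW Nm) _; exact: bigmin_le.
- apply/andP; split; last by rewrite (le_trans _ qm)// le_max lexx orbT.
  by apply: le_trans (ltW Nm) _; exact: bigmin_le_id.
Qed.

Lemma BMnorm_clarkson : exists q c : R, [/\ 0 < q, 0 < c & forall f g,
  measurable_scalar f -> measurable_scalar g -> (BM f <= 1)%E -> (BM g <= 1)%E ->
  ((2^-1%:E * BM (f + g)%R) `^ q + (c%:E * BM (f - g)%R) `^ q <= 1)%E].
Proof.
have [N [q [q2 sp sr]]] := ex_convexity_exponents.
have q0 : 0 < q by rewrite (lt_le_trans _ q2).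
have [c c0 cP] := @two_point_ineq R K N q q2.
exists q, c; split => // f g mf mg f1 g1.
set s : R := N.+2%:R / N.+1%:R in sp sr cP.
have s0 : 0 < s by rewrite divr_gt0.
have mB : measurable_scalar (f - g).
  by apply: measurable_scalarD => //; rewrite -scaleN1r; exact: measurable_scalarZ.
have mD := measurable_scalarD mf mg.
(* Absorbs the factor one half of the two-point inequality into the arguments of [lsum s]. *)
pose gam : R := 2^-1 `^ s^-1.
have gam0 : 0 <= gam by exact: powR_ge0.
have scale (a : R) (h : n.-tuple R -> K^o) : 0 <= a -> measurable_scalar h ->
    (a%:E * BM h = norm (fun x => (a * rnorm (h x))%:E))%E.
  move=> a0 mh; have /esym := BMnormZ p1' t (ltW r1) (ofR K a) mh.
  rewrite [rnorm _](rnorm_ofR (K := K) a0) => ->; rewrite BMnormE.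
  by congr BMenorm; apply/funext => x; rewrite rnormZ [rnorm (ofR K a)](rnorm_ofR (K := K) a0).
have msc (a : R) (h : n.-tuple R -> K^o) : measurable_scalar h -> measurable_fun setT (fun x => (a * rnorm (h x))%:E).
  by move=> mh; apply/measurable_EFinP; apply: measurable_funM => //; exact: measurable_rnorm.
have psc (a : R) (h : n.-tuple R -> K^o) x : 0 <= a -> (0 <= (a * rnorm (h x))%:E)%E.
  by move=> a0; rewrite lee_fin mulr_ge0 ?rnorm_ge0.
have half0 : 0 <= 2^-1 :> R by rewrite invr_ge0.
have c0' := ltW c0.
suff H : (lsum q (2^-1%:E * BM (f + g)%R) (c%:E * BM (f - g)%R) <= 1)%E.
  have := le_poweR (ltW q0) (lsum_ge0 _ _ _) H.
  rewrite poweR1r /lsum poweRVK// ?gt_eqF//.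
  by rewrite adde_ge0// poweR_ge0.
rewrite !scale//.
(* The reverse inequality with [q] moves [lsum] inside the norm, the two-point inequality is applied
   pointwise, and the direct inequality with [s] takes [lsum s] out again. *)
apply: le_trans (BMenorm_lsum_ge t p0 r0 (s := q) _ _ _ _ _ _) _.
- by move=> i; case/andP: (sp i).
- by case/andP: sr.
- exact: msc.
- exact: msc.
- by move=> x; exact: psc.
- by move=> x; exact: psc.
apply: (@le_trans _ _ (norm (fun x =>
    lsum s (gam * rnorm (f x))%:E (gam * rnorm (g x))%:E))).
  apply: (le_BMenorm t p0 r0).
  - by apply: measurable_lsum; exact: msc.
  - by apply: measurable_lsum; exact: msc.
  - by move=> x; exact: lsum_ge0.
  - move=> x; rewrite !lsumEFin lee_fin.
    have -> : (gam * rnorm (f x)) `^ s + (gam * rnorm (g x)) `^ s =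
        (rnorm (f x) `^ s + rnorm (g x) `^ s) / 2.
      rewrite !powRM ?rnorm_ge0// -mulrDr mulrC; congr (_ * _).
      by rewrite /gam -powRrM mulVf ?gt_eqF// powRr1.
    have := cP (f x) (g x); set W := (_ `^ s^-1) => H.
    have -> : W = (W `^ q) `^ q^-1 by rewrite -powRrM divff ?gt_eqF// powRr1// powR_ge0.
    apply: ge0_ler_powR => //; rewrite ?invr_ge0 ?(ltW q0)// nnegrE ?addr_ge0 ?powR_ge0//.
apply: le_trans (@BMenorm_lsum_le _ _ p t r r0 s
  (fun x => (gam * rnorm (f x))%:E) (fun x => (gam * rnorm (g x))%:E) s0 _ _ _ _ _ _) _.
- by move=> i; case/andP: (sp i).
- by case/andP: sr.
- exact: msc.
- exact: msc.
- by move=> x; exact: psc.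
- by move=> x; exact: psc.
rewrite -!scale//.
(* The [s]-th power of [gam] is one half, so this bound equals 1. *)
apply: (@le_trans _ _ (lsum s gam%:E gam%:E)).
  apply: le_lsum => //; rewrite ?mule_ge0 ?lee_fin ?BMnorm_ge0//.
    by rewrite -[leRHS]mule1 lee_wpmul2l ?lee_fin.
  by rewrite -[leRHS]mule1 lee_wpmul2l ?lee_fin.
rewrite lsumEFin lee_fin /gam -powRrM mulVf ?gt_eqF// powRr1//.
have -> : 2^-1 + 2^-1 = 1 :> R by field.
by rewrite powR1.
Qed.

End mixedBM_convexity.

Section mixedBM_quotient.
Context {R : realType} (K : scalarField R) {n : nat} {p : n.-tuple R} (t : R) {r : R}.
Variables (p1 : forall i, 1 <= tnth p i) (r1 : 1 <= r).
Implicit Types f g : BMfun K t p1 r1.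

Definition mixedBM_pi f : mixedBM K t p1 r1 :=
  (\pi_(seminorm_quot (BM_seminorm K t p1 r1)) f)%qT.

Lemma mixedBM_piP (x : mixedBM K t p1 r1) : exists f, x = mixedBM_pi f.
Proof. by elim/quotW: x => f; exists f. Qed.

Lemma rnorm_mixedBM_pi f : rnorm (mixedBM_pi f) = fine (BMnorm p t r f).
Proof. by rewrite /rnorm norm_seminorm_quot re_ofR. Qed.

Lemma mixedBM_piD f g : mixedBM_pi f + mixedBM_pi g = mixedBM_pi (f + g).
Proof. exact/esym/seminorm_quotD. Qed.

Lemma mixedBM_piB f g : mixedBM_pi f - mixedBM_pi g = mixedBM_pi (f - g).
Proof.
rewrite -[- mixedBM_pi g]scaleN1r -[- g]scaleN1r -mixedBM_piD; congr (_ + _).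
exact/esym/seminorm_quotZ.
Qed.

End mixedBM_quotient.

Lemma mixedBM_uniformly_convex (R : realType) (K : scalarField R) n (p : n.-tuple R)
    (t r : R) (p1 : forall i, 1 <= tnth p i) (r1 : 1 <= r) :
  (forall i, 1 < tnth p i) -> 1 < r -> uniformly_convex (mixedBM K t p1 r1).
Proof.
move=> p1' r1'; have [q [c [q0 c0 H]]] := BMnorm_clarkson K t p1' r1'.
(* Bound for the [q]-th power of half the sum once the difference exceeds [e]; truncated at [0]
   since [c * e] may exceed 1. *)
move=> e e0; pose z := Num.max 0 (1 - (c * e) `^ q).
have z0 : 0 <= z by rewrite le_max lexx.
have z1 : z < 1 by rewrite gt_max ltr01 ltrBlDr ltrDl powR_gt0// mulr_gt0.
(* A sum of norm above [2 - d] has half its norm above the [q]-th root of [z], which rules out a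
   difference above [e]. *)
exists (2 * (1 - z `^ q^-1)).
  rewrite mulr_gt0// subr_gt0 [ltRHS](_ : 1 = 1 `^ q^-1); last by rewrite powR1.
  by apply: gt0_ltr_powR; rewrite ?invr_gt0// nnegrE.
move=> x y; have [f ->] := mixedBM_piP x; have [g ->] := mixedBM_piP y.
rewrite mixedBM_piD mixedBM_piB !rnorm_mixedBM_pi => f1 g1 fg.
have [mf _] := BMfunP f; have [mg _] := BMfunP g.
have := H f g mf mg; rewrite -(fineK (BMnorm_fin f)) -(fineK (BMnorm_fin g)) !lee_fin.
move=> /(_ f1 g1); move: fg.
rewrite -[BMfun_val f + BMfun_val g]/(BMfun_val (f + g)).
rewrite -[BMfun_val f - BMfun_val g]/(BMfun_val (f - g)).
have := fineK (BMnorm_fin (f + g)); have := fineK (BMnorm_fin (f - g)).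
have : 0 <= fine (BMnorm p t r (f + g)) by apply: fine_ge0; exact: BMnorm_ge0.
move: (fine _) (fine _) => b a a0 <- <- fg.
rewrite -!EFinM !poweR_EFin -EFinD lee_fin => {}H.
rewrite leNgt; apply/negP => eb.
have {}a0 : 0 <= 2^-1 * a by rewrite mulr_ge0 ?invr_ge0.
have : z < (2^-1 * a) `^ q.
  have -> : z = (z `^ q^-1) `^ q by rewrite -powRrM mulVf ?gt_eqF// powRr1.
  by apply: gt0_ltr_powR; rewrite ?nnegrE ?powR_ge0//; lra.
have : (c * e) `^ q < (c * b) `^ q.
  apply: gt0_ltr_powR; rewrite ?nnegrE ?mulr_ge0 ?(ltW c0) ?(ltW e0)//.
    by rewrite (ltW (lt_trans e0 eb)).
  by rewrite ltr_pM2l.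
have : 1 - (c * e) `^ q <= z by rewrite le_max lexx orbT.
lra.
Qed.

(** * Bounded variation and limits of sequences with geometric steps *)

(** * Completeness *)

Section bounded_variation_sequences.
Context {R : realType}.
Implicit Types (a d : R^nat).

Lemma dist_le_sum_variation a d k m : (forall j, `|a j.+1 - a j| <= d j) ->
  `|a (k + m)%N - a k| <= \sum_(j < m) d (k + j)%N.
Proof.
move=> ad; elim: m => [|m IH]; first by rewrite addn0 subrr normr0 big_ord0.
rewrite big_ord_recr/= addnS -(subrK (a (k + m)%N) (a _.+1)) -addrA.
by apply: (le_trans (ler_normD _ _)); rewrite [leRHS]addrC lerD.
Qed.

(** The telescoping series converges absolutely. *)
Lemma cvgn_bounded_variation a d (M : R) : (forall j, `|a j.+1 - a j| <= d j) ->
  (forall m, \sum_(j < m) d j <= M) -> cvgn a.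
Proof.
move=> ad dM.
have /normed_cvg cv : cvgn [normed series (telescope a)].
  apply: nondecreasing_is_cvgn.
    by apply/nondecreasing_seqP => k; rewrite /= !seriesEnat/= big_nat_recr//= lerDl.
  exists M => _ [m _ <-]; rewrite /= seriesEnat/= big_mkord.
  by apply: le_trans (dM m); apply: ler_sum => j _; exact: ad.
rewrite (_ : a = (fun m => a 0%N + series (telescope a) m)).
  by apply: is_cvgD => //; exact: is_cvg_cst.
by apply/funext => m; exact: eq_sum_telescope.
Qed.

Lemma limn_bounded_variation a d (k : nat) (B : R) : (forall j, `|a j.+1 - a j| <= d j) ->
  cvgn a -> (forall m, \sum_(j < m) d (k + j)%N <= B) -> `|limn a - a k| <= B.
Proof.
move=> ad cva dB.
have cv : (fun m => `|a m - a k|) @ \oo --> `|limn a - a k|.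
  by apply: cvg_norm; apply: cvgB => //; exact: cvg_cst.
rewrite -(cvg_lim (@Rhausdorff R) cv); apply: limr_le; first by apply/cvg_ex; eexists; exact: cv.
exists k => // m /= km; rewrite -(subnKC km).
exact: le_trans (dist_le_sum_variation _ _ ad) (dB _).
Qed.

End bounded_variation_sequences.

(** Real and imaginary parts need not fill the plane: over the reals the second is always 0. This is
    what allows a limit scalar to be built from limits of parts. *)
Definition scalar_closed {R : realType} (K : scalarField R) :=
  forall (z : nat -> K) (a b : R), (fun k => re (z k)) @ \oo --> a ->
    (fun k => im (z k)) @ \oo --> b -> exists w : K, re w = a /\ im w = b.

Lemma real_scalar_closed (R : realType) : scalar_closed (real_scalar R).
Proof.
move=> z a b za zb; exists a; split => //=.
by rewrite -(cvg_lim (@Rhausdorff R) zb) /= lim_cst.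
Qed.

Lemma complex_scalar_closed (R : realType) : scalar_closed (complex_scalar R).
Proof. by move=> z a b _ _; exists (a +i* b)%C. Qed.

Section mixedBM_completeness.
Context {R : realType} (K : scalarField R) {n : nat} {p : n.-tuple R} (t : R) {r : R}.
Variables (p1 : forall i, 1 <= tnth p i) (r1 : 1 <= r).
Hypothesis Kclosed : scalar_closed K.

Let p0 i : 0 < tnth p i. Proof. exact: lt_le_trans (p1 i). Qed.
Let r0 : 0 < r. Proof. exact: lt_le_trans r1. Qed.

Local Notation BM := (BMnorm p t r).
Local Notation norm := (BMenorm p t r).

Section tails.
Variable f : nat -> n.-tuple R -> K^o.
Hypothesis mf : forall k, measurable_scalar (f k).
Hypothesis fN : forall k, (BM (f k.+1 - f k)%R <= (2^-1 ^+ k)%:E)%E.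

Let d k x : R := rnorm (f k.+1 x - f k x).
(** Taking [m.+1] terms makes [S k 0] a single step, the base case of [norm_S]. *)
Let S k m x : \bar R := (\sum_(j < m.+1) d (k + j) x)%:E.
Let G k x := ereal_sup (range (fun m => S k m x)).

Let d0 k x : 0 <= d k x. Proof. exact: rnorm_ge0. Qed.

Let mB g h : measurable_scalar g -> measurable_scalar h ->
  measurable_scalar (g - h : n.-tuple R -> K^o).
Proof.
move=> mg mh; apply: measurable_scalarD => //.
by rewrite -scaleN1r; exact: measurable_scalarZ.
Qed.

Let md k : measurable_fun setT (d k).
Proof. by apply: measurable_rnorm; exact: mB. Qed.

Let mS k m : measurable_fun setT (S k m).
Proof.
apply/measurable_EFinP; apply: (@measurable_sum _ _ R setT 'I_m.+1 _ (fun j => d (k + j)%N)) => j.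
exact: md.
Qed.

Let S0 k m x : (0 <= S k m x)%E.
Proof. by rewrite lee_fin sumr_ge0. Qed.

Let ndS k x : nondecreasing_seq (fun m => S k m x).
Proof.
by apply/nondecreasing_seqP => m; rewrite lee_fin [leRHS]big_ord_recr/= lerDl.
Qed.

Let mG k : measurable_fun setT (G k).
Proof. by apply: measurable_ereal_sup => m; exact: mS. Qed.

Let G0 k x : (0 <= G k x)%E.
Proof. by apply: le_trans (S0 k 0%N x) _; apply: ereal_sup_ubound; exists 0%N. Qed.

(** The bound is the geometric sum over the steps [k] to [k + m]; the triangle inequality is
    [BMenorm_lsum_le] at exponent 1. *)
Let norm_S k m : (norm (S k m) <= (2^-1 ^+ k * (2 - 2^-1 ^+ m))%:E)%E.
Proof.
have Nd j : (norm (fun x => (d j x)%:E) <= (2^-1 ^+ j)%:E)%E.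
  by apply: le_trans (fN j); rewrite BMnormE.
elim: m => [|m IH].
  rewrite (_ : S k 0 = fun x => (d k x)%:E); last first.
    by apply/funext => x; rewrite /S big_ord1 addn0.
  by apply: le_trans (Nd k) _; rewrite expr0 lee_fin -[leLHS]mulr1 ler_wpM2l ?exprn_ge0//; lra.
rewrite (_ : S k m.+1 = fun x => lsum 1 (S k m x) (d (k + m.+1) x)%:E); last first.
  by apply/funext => x; rewrite lsum1// ?lee_fin// /S big_ord_recr/= EFinD.
apply: le_trans (BMenorm_lsum_le t r0 ltr01 p1 r1 (mS k m) _ (S0 k m) _) _.
- by apply/measurable_EFinP; exact: md.
- by move=> x; rewrite lee_fin.
rewrite lsum1 ?pfnorm_ge0//; apply: le_trans (leeD IH (Nd _)) _.
rewrite -EFinD lee_fin exprD exprS -mulrDr ler_wpM2l ?exprn_ge0//; lra.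
Qed.

Let norm_G k : (norm (G k) <= (2 * 2^-1 ^+ k)%:E)%E.
Proof.
apply: le_trans (BMenorm_sup t p0 r0 (mS k) (S0 k) (ndS k)) _.
apply: ge_ereal_sup => _ [m _ <-] /=; apply: le_trans (norm_S k m) _.
by rewrite lee_fin mulrC ler_wpM2r ?exprn_ge0// gerBl exprn_ge0.
Qed.

(** The first [k] steps have a finite sum, so a single set of good points serves every [k]. *)
Let G_le0 k x : (G k x < +oo)%E -> (G 0%N x < +oo)%E.
Proof.
move=> Gk; apply: (@le_lt_trans _ _ ((\sum_(j < k) d j x)%:E + G k x)%E); last first.
  by rewrite lte_add_pinfty// ltry.
apply: ge_ereal_sup => _ [m _ <-].
apply: (@le_trans _ _ ((\sum_(j < k) d j x)%:E + S k m x)%E).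
  rewrite -EFinD lee_fin.
  apply: (@le_trans _ _ (\sum_(j < k + m.+1) d j x)).
    rewrite [in leRHS]addnC big_split_ord/=.
    by rewrite (eq_bigr (fun j : 'I_m.+1 => d j x))// lerDl sumr_ge0.
  by rewrite big_split_ord.
by rewrite leeD2l//; apply: ereal_sup_ubound; exists m.
Qed.

Let cvg_part (h : K -> R) : {morph h : x y / x - y} -> (forall z, `|h z| <= rnorm z) ->
  forall x, (G 0%N x < +oo)%E -> cvgn (fun k => h (f k x)) /\
  forall k, (`|limn (fun k => h (f k x)) - h (f k x)|%:E <= G k x)%E.
Proof.
move=> hB hle x G0oo.
have had j : `|h (f j.+1 x) - h (f j x)| <= d j x by rewrite -hB; exact: hle.
have dG k m : ((\sum_(j < m) d (k + j)%N x)%:E <= G k x)%E.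
  apply: (@le_trans _ _ (S k m x)); last by apply: ereal_sup_ubound; exists m.
  by rewrite lee_fin [leRHS]big_ord_recr/= lerDl.
have cv : cvgn (fun k => h (f k x)).
  apply: (cvgn_bounded_variation (M := fine (G 0%N x)) had) => m.
  by rewrite -lee_fin fineK ?ge0_fin_numE//; exact: (dG 0%N).
split=> // k; have [Gk|Gk] := ltP (G k x) +oo%E; last by move: Gk; rewrite leye_eq => /eqP ->; exact: leey.
rewrite -(fineK (x := G k x)) ?ge0_fin_numE// lee_fin.
apply: (limn_bounded_variation had cv) => m.
by rewrite -lee_fin fineK ?ge0_fin_numE.
Qed.

Lemma BMnorm_limit : exists g : n.-tuple R -> K^o, measurable_scalar g /\
  forall k, (BM (g - f k)%R <= (4 * 2^-1 ^+ k)%:E)%E.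
Proof.
(* Points of finite total variation: [g] will be the pointwise limit there and [0] elsewhere. *)
pose E := [set x | (G 0%N x < +oo)%E].
have mE : measurable E.
  rewrite (_ : E = ~` (G 0%N @^-1` [set +oo%E])).
    apply: measurableC; rewrite -[X in measurable X]setTI; exact: mG.
  by apply/seteqP; split => x /=; rewrite /E/= ltey => /eqP.
have reP x Ex := @cvg_part (@re R K) (@reB R K) (@normr_re_le R K) x Ex.
have imP x Ex := @cvg_part (@im R K) (@imB R K) (@normr_im_le R K) x Ex.
have /choice[g gP] : forall x, exists w : K, (E x -> re w = limn (fun k => re (f k x)) /\
    im w = limn (fun k => im (f k x))) /\ (~ E x -> w = 0).
  move=> x; have [Ex|nEx] := pselect (E x); last by exists 0.
  have [w wP] := Kclosed (z := fun k => f k x) (reP x Ex).1 (imP x Ex).1.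
  by exists w.
have mpart (h : K -> R) : h 0 = 0 -> (forall k, measurable_fun setT (h \o f k)) ->
    (forall x, E x -> (fun k => h (f k x)) @ \oo --> h (g x)) -> measurable_fun setT (h \o g).
  move=> h0 mhf hcv.
  (* The indicator of [E] makes the sequence converge everywhere, off [E] to [h 0 = 0]. *)
  apply: (@measurable_fun_cvg _ _ _ _ (fun k => (h \o f k) \* \1_E)).
    by move=> k; apply: measurable_funM => //; exact: measurable_indic.
  move=> x _ /=; have [Ex|nEx] := pselect (E x).
    rewrite (_ : (fun k => _) = (fun k => h (f k x))); first exact: hcv.
    by apply/funext => k; rewrite indicE mem_set//= mulr1.
  rewrite (gP x).2// h0 (_ : (fun k => _) = (fun k => 0)); first exact: cvg_cst.
  by apply/funext => k; rewrite indicE memNset//= mulr0.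
have mg : measurable_scalar g.
  split.
    apply: mpart; [exact: re0|by move=> k; case: (mf k)|].
    by move=> x Ex; rewrite ((gP x).1 Ex).1; case: (reP x Ex).
  apply: mpart; [exact: im0|by move=> k; case: (mf k)|].
  by move=> x Ex; rewrite ((gP x).1 Ex).2; case: (imP x Ex).
exists g; split=> // k; rewrite BMnormE.
(* Real and imaginary parts of the error are each at most [G k]; two norms of at most
   [2 * 2^-1 ^+ k] give the factor 4. *)
apply: (@le_trans _ _ (norm (fun x => lsum 1 (G k x) (G k x)))).
  apply: (le_BMenorm t p0 r0).
  - by apply/measurable_EFinP; apply: measurable_rnorm; exact: mB.
  - by apply: measurable_lsum; exact: mG.
  - by move=> x; rewrite lee_fin rnorm_ge0.
  - move=> x; rewrite lsum1//.
    (* Off [E] the function [G k] is infinite, so the value [0] chosen there for [g] respects the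
       bound. *)
    have [Gk|Gk] := ltP (G k x) +oo%E; last first.
      by move: Gk; rewrite leye_eq => /eqP ->; rewrite leey.
    have Ex : E x by exact: G_le0 Gk.
    apply: (@le_trans _ _ (`|re (g x - f k x)| + `|im (g x - f k x)|)%:E).
      by rewrite lee_fin; exact: rnorm_le_reim.
    rewrite EFinD reB imB ((gP x).1 Ex).1 ((gP x).1 Ex).2.
    by apply: leeD; [apply: (reP x Ex).2|apply: (imP x Ex).2].
apply: le_trans (BMenorm_lsum_le t r0 ltr01 p1 r1 (mG k) (mG k) (G0 k) (G0 k)) _.
rewrite lsum1 ?pfnorm_ge0//; apply: le_trans (leeD (norm_G k) (norm_G k)) _.
by rewrite -EFinD lee_fin; lra.
Qed.

End tails.

Lemma mixedBM_complete : geometrically_complete (mixedBM K t p1 r1).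
Proof.
move=> u uN; have /choice[f fP] := fun k => mixedBM_piP (u k).
have {}uN k : (BM (BMfun_val (f k.+1) - BMfun_val (f k))%R <= (2^-1 ^+ k)%:E)%E.
  have := uN k; rewrite !fP mixedBM_piB rnorm_mixedBM_pi -lee_fin.
  by rewrite fineK// BMnorm_fin.
have mf k : measurable_scalar (f k) by case: (BMfunP (f k)).
have [g [mg gP]] := BMnorm_limit mf uN.
(* [g] is the sum of [g - f 0], of norm at most 4, and of [f 0]. *)
have gBM : g \in BM_pred t p1 r1.
  rewrite inE; split => //.
  have mgf : measurable_scalar (g - f 0%N : n.-tuple R -> K^o).
    apply: measurable_scalarD => //; rewrite -scaleN1r.
    exact: measurable_scalarZ (mf 0%N).
  rewrite -(subrK (BMfun_val (f 0%N)) g).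
  apply: (le_lt_trans (BMnormD p1 t r1 mgf (mf 0%N))).
  rewrite lte_add_pinfty//; first exact: le_lt_trans (gP 0%N) (ltry _).
  by case: (BMfunP (f 0%N)).
exists (mixedBM_pi (MkBMfun gBM)) => k.
rewrite fP mixedBM_piB rnorm_mixedBM_pi -lee_fin fineK ?BMnorm_fin//.
exact: gP.
Qed.

End mixedBM_completeness.

Theorem corollary5p14 (R : realType) (n : nat) (p : n.-tuple R) (t r : R)
    (hp : forall i, 1 < tnth p i)
    (hd : 1 < n%:R / \sum_(i < n) (tnth p i)^-1)
    (ht : n%:R / \sum_(i < n) (tnth p i)^-1 < t)
    (hr : t < r) :
  let p1 := fun i => ltW (hp i) in
  let r1 := ltW (lt_trans hd (lt_trans ht hr)) in
  reflexive_space (mixedBM (real_scalar R) t p1 r1) /\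
  reflexive_space (mixedBM (complex_scalar R) t p1 r1).
Proof.
(* Uniform convexity asks for the strict bound [1 < r], while [r1] records only the weak one. *)
move=> p1 r1; have r1' := lt_trans hd (lt_trans ht hr).
split; apply: milman_pettis; try exact: mixedBM_uniformly_convex.
- exact/mixedBM_complete/real_scalar_closed.
- exact/mixedBM_complete/complex_scalar_closed.
Qed.
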